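(* Let $\Sigma$ be a conical polyhedral complex (with integral structure) admitting a slicing function $h:\Sigma\to\mathbb{R}$, and let $\Sigma_0\subset\Sigma$ be a subcomplex. Let $\Sigma_0'$ be a triangulation of $\Sigma_0$ induced by a lifting function. Then there exists a triangulation $\Sigma'$ of $\Sigma$, also induced by a lifting function, which extends $\Sigma_0'$ and introduces no new edges, that is, $\mathrm{Sk}^1(\Sigma')=\mathrm{Sk}^1(\Sigma)\cup\mathrm{Sk}^1(\Sigma_0')$.
   Context: Conical polyhedral complex (in the sense of Kempf–Knudsen–Mumford–Saint-Donat, Toroidal Embeddings I): a topological space $|\Sigma|$ with a finite family of closed subsets $\sigma_\alpha$ (cones) and, for each, a finite-dimensional real vector space $V_\alpha$ of continuous real functions on $\sigma_\alpha$, such that: a basis $f_1,\ldots,f_k$ of $V_\alpha$ gives a homeomorphism of $\sigma_\alpha$ onto a strictly convex polyhedral cone in $\mathbb{R}^k$ not contained in a hyperplane; the preimages of the faces of this cone are again cells $\sigma_\beta$ (the faces of $\sigma_\alpha$), with $V_\beta=V_\alpha|_{\sigma_\beta}$; and $|\Sigma|$ is the disjoint union of the relative interiors of the cells. The common vertex of the cones is the origin $\mathbf{O}$. An integral structure is a choice of finitely generated subgroups (lattices) $L_\alpha\subset V_\alpha$ with $L_\alpha\otimes\mathbb{R}\cong V_\alpha$, compatible with restriction to faces, for which each cone is rational; the dual lattice of $L_\alpha$ gives the lattice of integral points of $\sigma_\alpha$. All complexes carry an integral structure. $\mathrm{Sk}^1(\Sigma)$ is the $1$-skeleton of $\Sigma$,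 i.e. its edges (one-dimensional cones). A slicing function $h:\Sigma\to\mathbb{R}$ is a nonnegative continuous function whose restriction to every cone $\sigma\in\Sigma$ is linear and which vanishes only at the origin $\mathbf{O}\in\Sigma$. A subdivision $\Sigma'$ of $\Sigma$ is a finite (rational) polyhedral decomposition of $\Sigma$ into cones, each contained in a cone of $\Sigma$, closed under taking faces and with any two cones lying in a common cone of $\Sigma$ meeting in a common face, and with $|\Sigma'|=|\Sigma|$. It is a triangulation (simplicial subdivision) if every cone of $\Sigma'$ is simplicial. $\Sigma'$ extends a subdivision $\Sigma_0'$ of $\Sigma_0$ if the restriction of $\Sigma'$ to $\Sigma_0$ is $\Sigma_0'$. A lifting function $f:\Sigma\to\mathbb{R}$ is a continuous function on $|\Sigma|$, homogeneous ($f(\lambda x)=\lambda f(x)$ for all $\lambda\ge0$), which on each cone is piecewise linear and ''convex down'', i.e. $f(\lambda x+\mu y)\ge\lambda f(x)+\mu f(y)$ for $\lambda,\mu\ge0$, and which respects the integral structure, taking rational values on the lattice points of the cones. The subdivision induced by $f$ is the coarsest subdivision of $\Sigma$ such that $f$ is linear on each of its cones. Lifting functions on $\Sigma_0$ are defined in the same way, with $\Sigma_0$ as the complex. *)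

(* Defs.v *)
From mathcomp Require Import all_boot all_order all_algebra.
From mathcomp Require Import all_classical all_reals all_analysis.

Set Implicit Arguments.
Unset Strict Implicit.
Unset Printing Implicit Defensive.

Import Order.TTheory GRing.Theory Num.Theory.
Import numFieldNormedType.Exports.

Local Open Scope classical_set_scope.
Local Open Scope ring_scope.

Section Cones.
Context {R : realType}.

Definition conic_hull (k m : nat) (v : 'I_m -> 'rV[R]_k) : set 'rV[R]_k :=
  [set x | exists2 c : 'I_m -> R, (forall i, 0 <= c i)
                                & x = \sum_(i < m) c i *: v i].

Definition polyhedral_cone (k : nat) (C : set 'rV[R]_k) : Prop :=
  exists m (v : 'I_m -> 'rV[R]_k), C = conic_hull v.

(* Rational with respect to the standard lattice Z^k. *)
Definition rational_cone (k : nat) (C : set 'rV[R]_k) : Prop :=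
  exists m (v : 'I_m -> 'rV[rat]_k),
    C = conic_hull (fun i => map_mx ratr (v i)).

Definition simplicial_cone (k : nat) (C : set 'rV[R]_k) : Prop :=
  exists m (v : 'I_m -> 'rV[R]_k),
    row_free (\matrix_(i < m) v i) /\ C = conic_hull v.

Definition strictly_convex (k : nat) (C : set 'rV[R]_k) : Prop :=
  forall x, C x -> C (- x) -> x = 0.

Definition in_hyperplane (k : nat) (C : set 'rV[R]_k) : Prop :=
  exists2 l : 'cV[R]_k, l != 0 & forall x, C x -> x *m l = 0.

(* Faces are cut out by supporting hyperplanes; l = 0 gives C itself. *)
Definition is_face (k : nat) (C F : set 'rV[R]_k) : Prop :=
  exists2 l : 'cV[R]_k, (forall x, C x -> 0 <= (x *m l) 0 0)
                      & F = C `&` [set x | x *m l = 0].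

(* C contains d vectors that form a basis of its linear span. *)
Definition has_dim (k : nat) (C : set 'rV[R]_k) (d : nat) : Prop :=
  exists A : 'M[R]_(d, k),
    [/\ row_free A, forall i, C (row i A) & forall x, C x -> (x <= A)%MS].

End Cones.

Section Charts.
Context {R : realType} {X : Type}.

Definition basis_of (V : set (X -> R)) (k : nat) (f : 'I_k -> X -> R) : Prop :=
  let comb (c : 'rV[R]_k) := fun x => \sum_(i < k) c 0 i * f i x in
  injective comb /\ V = range comb.

Definition Zspan (k : nat) (f : 'I_k -> X -> R) : set (X -> R) :=
  range (fun (c : 'rV[int]_k) x => \sum_(i < k) (c 0 i)%:~R * f i x).

Definition chart (k : nat) (f : 'I_k -> X -> R) (x : X) : 'rV[R]_k :=
  \row_(i < k) f i x.

(* T and F are subsets of a cell with function space V. *)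
Definition face_in (V : set (X -> R)) (T F : set X) : Prop :=
  F `<=` T /\ exists k (f : 'I_k -> X -> R),
    basis_of V f /\ is_face (chart f @` T) (chart f @` F).

End Charts.

(* The restriction of f to A is a homeomorphism of A onto B. *)
Definition homeomorphism_onto (X Y : topologicalType) (A : set X) (B : set Y)
    (f : X -> Y) : Prop :=
  [/\ {within A, continuous f}, f @` A = B
    & exists2 g : Y -> X, {within B, continuous g} & {in A, cancel f g}].

(* The relative interior of a cell, computed in a chart: the image of the cell
   spans R^k, so its relative interior is its topological interior. *)
Definition relint_in {R : realType} {X : Type} (V : set (X -> R)) (T : set X) :
    set X :=
  [set x | T x /\ exists k (f : 'I_k -> X -> R),
     basis_of V f /\ interior (chart f @` T) (chart f x)].

(* A real function on a cell sigma is encoded by its extension by zero to the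
   whole space; [u \_ sigma] is then the restriction of u to sigma.  The
   linear functions on the cell a are the elements of [linear_fun a]. *)
Record conicalComplex (R : realType) := ConicalComplex {
  carrier :> topologicalType;
  cell : finType;
  cone : cell -> set carrier;
  linear_fun : cell -> set (carrier -> R);
  origin : carrier;
  cone_closed : forall a, closed (cone a);
  linear_fun_out : forall a u x, linear_fun a u -> ~ cone a x -> u x = 0;
  linear_fun_continuous :
    forall a u, linear_fun a u -> {within cone a, continuous u};
  linear_fun_findim :
    forall a, exists k (f : 'I_k -> carrier -> R), basis_of (linear_fun a) f;
  cone_chart :
    forall a k (f : 'I_k -> carrier -> R), basis_of (linear_fun a) f ->
    exists C : set 'rV[R]_k,
      [/\ homeomorphism_onto (cone a) C (chart f),
          polyhedral_cone C, strictly_convex C & ~ in_hyperplane C];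
  cone_face :
    forall a (F : set carrier), face_in (linear_fun a) (cone a) F ->
    exists b, cone b = F /\
      linear_fun b = [set u \_ (cone b) | u in linear_fun a];
  cone_partition :
    forall x, exists! a, relint_in (linear_fun a) (cone a) x;
  originP :
    forall a, cone a origin /\ forall u, linear_fun a u -> u origin = 0
}.

Section Complexes.
Context {R : realType} (S : conicalComplex R).
Implicit Types (a b : cell S) (T F : set S) (K : set (cell S)).
Implicit Types (D : set (set S)) (f h : S -> R).

Definition face_of b a : Prop := face_in (linear_fun a) (cone a) (cone b).

(* A subcomplex is given by its set of cells, so [setT] stands for S. *)
Definition subcomplex K : Prop :=
  forall a b, K a -> face_of b a -> K b.

Definition support K : set S := \bigcup_(a in K) cone a.

(* z = l x + m y, tested by the linear functions, which are the coordinates *)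
Definition conic_comb a (l : R) (x : S) (m : R) (y z : S) : Prop :=
  [/\ cone a x, cone a y, cone a z
    & forall u, linear_fun a u -> u z = l * u x + m * u y].

Definition linear_on a T f : Prop :=
  exists2 u, linear_fun a u & forall x, T x -> f x = u x.

Definition slicing_function h : Prop :=
  [/\ continuous h, forall x, 0 <= h x,
      forall a, linear_on a (cone a) h
    & forall x, h x = 0 <-> x = origin S].

Definition polyhedral_in a T : Prop :=
  T `<=` cone a /\ exists k (f : 'I_k -> S -> R),
    basis_of (linear_fun a) f /\ polyhedral_cone (chart f @` T).

Definition piecewise_linear_on a f : Prop :=
  exists n (T : 'I_n -> set S),
    [/\ cone a = \bigcup_i T i, forall i, polyhedral_in a (T i)
      & forall i, linear_on a (T i) f].

Definition simplicial T : Prop :=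
  exists a, T `<=` cone a /\ exists k (f : 'I_k -> S -> R),
    basis_of (linear_fun a) f /\ simplicial_cone (chart f @` T).

Definition is_edge T : Prop :=
  exists a, T `<=` cone a /\ exists k (f : 'I_k -> S -> R),
    basis_of (linear_fun a) f /\ has_dim (chart f @` T) 1.

Definition cones : set (set S) := range (@cone R S).

Definition Sk1 D : set (set S) := [set T | D T /\ is_edge T].

Definition restriction K D : set (set S) :=
  [set T | D T /\ exists2 a, K a & T `<=` cone a].

End Complexes.

(* L_a is finitely generated with L_a (x) R = V_a: it is the group generated by
   some basis of V_a. *)
Definition lattice_basis_of {R : realType} {X : Type} (V L : set (X -> R))
    (k : nat) (f : 'I_k -> X -> R) : Prop :=
  basis_of V f /\ L = Zspan f.

Record integralStructure (R : realType) (S : conicalComplex R) :=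
    IntegralStructure {
  lattice : cell S -> set (S -> R);
  latticeP : forall a, exists k (f : 'I_k -> S -> R),
    lattice_basis_of (linear_fun a) (lattice a) f;
  lattice_face : forall a b, face_of b a ->
    lattice b = [set u \_ (cone b) | u in lattice a];
  lattice_rational : forall a k (f : 'I_k -> S -> R),
    lattice_basis_of (linear_fun a) (lattice a) f ->
    rational_cone (chart f @` cone a)
}.

Section Subdivisions.
Context {R : realType} {S : conicalComplex R} (L : integralStructure S).
Implicit Types (a b : cell S) (T F : set S) (K : set (cell S)).
Implicit Types (D : set (set S)) (f : S -> R).

Definition integral_point a : set S :=
  [set x | cone a x /\ forall u, lattice L a u -> u x \is a Num.int].

Definition rational_in a T : Prop :=
  T `<=` cone a /\ exists k (f : 'I_k -> S -> R),
    lattice_basis_of (linear_fun a) (lattice L a) f /\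
    rational_cone (chart f @` T).

(* A lifting function on the subcomplex K; the values of f outside of the
   support of K are irrelevant. *)
Record lifting_function K f : Prop := LiftingFunction {
  lifting_continuous : {within support K, continuous f};
  lifting_homogeneous : forall a l x z, K a -> 0 <= l ->
    conic_comb a l x 0 x z -> f z = l * f x;
  lifting_piecewise_linear : forall a, K a -> piecewise_linear_on a f;
  lifting_convex : forall a l m x y z, K a -> 0 <= l -> 0 <= m ->
    conic_comb a l x m y z -> l * f x + m * f y <= f z;
  lifting_rational : forall a x, K a -> integral_point a x ->
    exists q : rat, f x = ratr q
}.

Record subdivision K D : Prop := Subdivision {
  subdivision_finite : finite_set D;
  subdivision_cone : forall T, D T -> exists2 a, K a & rational_in a T;
  subdivision_face : forall a T F, K a -> D T -> T `<=` cone a ->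
    face_in (linear_fun a) T F -> D F;
  subdivision_meet : forall a T1 T2, K a -> D T1 -> D T2 ->
    T1 `<=` cone a -> T2 `<=` cone a ->
    face_in (linear_fun a) T1 (T1 `&` T2) /\
    face_in (linear_fun a) T2 (T1 `&` T2);
  subdivision_support : \bigcup_(T in D) T = support K
}.

Definition triangulation K D : Prop :=
  subdivision K D /\ forall T, D T -> simplicial T.

Definition linear_on_cones K D f : Prop :=
  forall a T, K a -> D T -> T `<=` cone a -> linear_on a T f.

(* D is the coarsest subdivision of K on whose cones f is linear: every other
   one refines it. *)
Definition induced_by K f D : Prop :=
  [/\ subdivision K D, linear_on_cones K D f
    & forall D', subdivision K D' -> linear_on_cones K D' f ->
        forall T', D' T' -> exists2 T, D T & T' `<=` T].

Definition induced_by_lifting K D : Prop :=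
  exists2 f, lifting_function K f & induced_by K f D.

End Subdivisions.

(* Main.v *)
Require Import Defs.
From mathcomp Require Import all_boot all_order all_algebra.
From mathcomp Require Import all_classical all_reals all_analysis.
From mathcomp Require Import ring lra.
Require Import Defs.

(** The triangulation is a regular one.  Choose on every ray of
    [Sk1 Sigma] and of [Sk1 D0] an integral generator [v i], and a rational
    height [w i] for each of them.  On a cell [a] consider the linear functions
    [u] with [w i <= u (v i)] for all generators in [a], the majorants of [w].
    Their pointwise minimum is the concave upper hull of the heights, and the
    cones spanned by the generators at which a given majorant is tight are the
    cones on which that minimum is linear ([majorant_exists], a form of linear
    programming duality derived from Farkas' lemma).  A linear combination of
    generators that lands in a face only involves generators of that face, so
    these cones and the upper hull do not depend on the cell in which they are
    computed ([contact_cone_restrict], [contact_cone_extend]); they form a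
    subdivision of the whole complex ([regular_subdivisionP]) induced by the
    upper hull ([regular_coarsest]).  As every cone is spanned by generators
    among the [v i], all its edges are edges of [Sigma] or of [D0].

    It remains to choose the heights.  Let [D0] be induced by [f0], and start
    with the heights [f0 (v i)] on the rays in [S0] and [0] elsewhere.  Because
    [f0] is concave and linear on the simplicial cones of [D0], it is the upper
    hull of these heights over [S0] ([base_upper_hull]), and since a function
    induces at most one subdivision, [D0] is the regular subdivision of [S0]
    that they define ([base_regular]).  The faces that [S0] leaves free need not
    become simplicial, not even if all the free heights are generic, because a
    cell of [Sigma] may have all its edges in [S0].  So every height is
    perturbed, by [t ^ (i + 1)] for the small rational [t = 1 / (n + 1)].  A
    linear dependency between generators on which a majorant is tight would be
    a linear relation between the heights, that is, a root of a nonzero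
    polynomial in [t]; for large [n] there is none, and all the cones are
    simplicial ([perturbed_independent]).  On the other hand the cones of [D0]
    are simplicial, hence their majorants can follow the perturbation, so that
    they persist for large [n] ([perturbed_stable]).  A subdivision contained in
    another one of the same complex is equal to it ([subdivision_incl]), and
    thus the perturbed subdivision restricts to [D0] on [S0].

    The space of the complex is abstract, and so points of a cell are compared
    through the linear functions on it.  What ties the cells together is that
    each point lies in the relative interior of a single cell, which is a face
    of every cell containing the point ([relint_cell_subcell]). *)

Set Implicit Arguments.
Unset Strict Implicit.
Unset Printing Implicit Defensive.

Import Order.TTheory GRing.Theory Num.Theory.
Import numFieldNormedType.Exports.

Local Open Scope classical_set_scope.
Local Open Scope ring_scope.

(** * Farkas' lemma *)

Section Farkas.
Context {R : realFieldType} {W : lmodType R}.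

Definition functional (g : W -> R) : Prop :=
  forall r x y, g (r *: x + y) = r * g x + g y.

Lemma functional0 g : functional g -> g 0 = 0.
Proof. by move=> gl; have := gl 1 0 0; rewrite scaler0 addr0 mul1r; lra. Qed.

Lemma functionalZ g r x : functional g -> g (r *: x) = r * g x.
Proof. by move=> gl; rewrite -[r *: x]addr0 gl functional0 // addr0. Qed.

(** Bartl's proof, by induction on the number of functionals.  If the first
    functional [A] cannot be dropped, there is an [x1] with [g x1 < 0] at which
    all the others are nonnegative, and then [A x1 < 0].  Subtracting the right multiples of [A] makes all functionals
    vanish at [x1], and the induction hypothesis applies to the other ones.  The
    sign of [A x1] makes the coefficient of [A] nonnegative. *)
Lemma farkas m (a : 'I_m -> W -> R) (g : W -> R) :
  (forall i, functional (a i)) -> functional g ->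
  (forall x, (forall i, 0 <= a i x) -> 0 <= g x) ->
  exists2 c : 'I_m -> R, (forall i, 0 <= c i)
                       & forall x, g x = \sum_(i < m) c i * a i x.
Proof.
elim: m a g => [|m IH] a g al gl ag.
  exists (fun=> 0) => // x; rewrite big_ord0; apply/eqP.
  have gx y : 0 <= g y by apply: ag => -[].
  by rewrite eq_le gx andbT -oppr_ge0 -mulN1r -functionalZ.
have [ag'|] := pselect (forall x,
    (forall i, 0 <= a (lift ord0 i) x) -> 0 <= g x).
  have [//|c c0 gE] := IH (fun i => a (lift ord0 i)) g (fun i => al _) gl.
  exists (fun i => if unlift ord0 i is Some j then c j else 0).
    by move=> i; case: unliftP.
  move=> x; rewrite big_ord_recl /= unlift_none mul0r add0r gE.
  by apply: eq_bigr => i _; rewrite liftK.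
move=> /existsNP[x1 /not_implyP[x1a /negP]]; rewrite -ltNge => gx1.
set A := a ord0.
have Al : functional A by apply: al.
have A1 : A x1 < 0.
  rewrite ltNge; apply/negP => A1; move: gx1; rewrite ltNge => /negP; apply.
  by apply: ag => i; case: (unliftP ord0 i) => [j ->|->].
have A1n : A x1 != 0 by rewrite lt_eqF.
pose t i := a (lift ord0 i) x1 / A x1.
pose b i x := a (lift ord0 i) x - t i * A x.
pose g' x := g x - g x1 / A x1 * A x.
have t0 i : t i <= 0 by rewrite mulr_ge0_le0 // invr_le0 ltW.
have [||x bx|c c0 gE] := IH b g'.
- by move=> i r x y; rewrite /b al Al; ring.
- by move=> r x y; rewrite /g' gl Al; ring.
- pose y := (- (A x / A x1)) *: x1 + x.
  have -> : g' x = g y by rewrite /y gl /g'; ring.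
  apply: ag => i; case: (unliftP ord0 i) => [j ->|->]; last first.
    by rewrite -/A Al mulNr divfK // addNr.
  by have := bx j; rewrite al /b /t; congr (0 <= _); ring.
pose c' := g x1 / A x1 - \sum_(i < m) c i * t i.
exists (fun i => if unlift ord0 i is Some j then c j else c').
  move=> i; case: unliftP => //= _; rewrite /c' subr_ge0.
  apply: (@le_trans _ _ 0).
    by apply: sumr_le0 => j _; rewrite mulr_ge0_le0.
  by rewrite mulr_le0 // ?invr_le0 ltW.
move=> x; rewrite big_ord_recl /= unlift_none -/A.
under eq_bigr do rewrite liftK.
have -> : g x = g' x + g x1 / A x1 * A x by rewrite /g'; ring.
rewrite gE /c' mulrBl mulr_suml.
have -> : \sum_(i < m) c i * b i x =
    \sum_(i < m) c i * a (lift ord0 i) x - \sum_(i < m) c i * t i * A x.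
  by rewrite -sumrB; apply: eq_bigr => i _; rewrite /b; ring.
ring.
Qed.

Lemma farkas_fin (I : finType) (a : I -> W -> R) (g : W -> R) :
  (forall i, functional (a i)) -> functional g ->
  (forall x, (forall i, 0 <= a i x) -> 0 <= g x) ->
  exists2 c : I -> R, (forall i, 0 <= c i)
                    & forall x, g x = \sum_i c i * a i x.
Proof.
move=> al gl ag; have [||x ax|c c0 gE] := @farkas #|I| (fun j => a (enum_val j)) g.
- by move=> i; exact: al.
- exact: gl.
- by apply: ag => i; rewrite -[i]enum_rankK.
exists (fun i => c (enum_rank i)) => // x; rewrite gE.
rewrite (reindex_onto (@enum_rank I) enum_val) => [|i _]; last exact: enum_valK.
by apply: eq_big => [i|i _]; rewrite enum_rankK ?eqxx.
Qed.

End Farkas.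

Lemma sum_option (R : nmodType) (I : finType) (F : option I -> R) :
  \sum_o F o = F None + \sum_i F (Some i).
Proof.
rewrite (bigD1 None) //=; congr (_ + _).
by rewrite (reindex_omap Some id) => [|[]] //; apply: eq_bigl => i; rewrite eqxx.
Qed.

(** Finitely many strict inequalities survive a small perturbation. *)
Lemma small_step (R : realFieldType) (I : finType) (P : pred I)
    (al be : I -> R) :
  (forall i, P i -> 0 < al i) ->
  exists2 e : R, 0 < e & forall i, P i -> 0 < al i + e * be i.
Proof.
move=> al0; pose s := \sum_(i | P i) `|be i| / al i.
have s0 : 0 <= s by apply: sumr_ge0 => i Pi; rewrite divr_ge0 // ltW // al0.
exists (1 + s)^-1 => [|i Pi]; first by rewrite invr_gt0; lra.
have ai := al0 i Pi.
have : `|be i| / al i <= s.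
  rewrite /s (bigD1 i) //= lerDl; apply: sumr_ge0 => j /andP[Pj _].
  by rewrite divr_ge0 // ltW // al0.
rewrite ler_pdivrMr // => bs.
have : (1 + s)^-1 * `|be i| < al i.
  rewrite mulrC ltr_pdivrMr; last by lra.
  by rewrite mulrDr mulr1 mulrC; rewrite mulrC in bs; lra.
have := ler_norm (- be i); rewrite normrN => nb.
have : (1 + s)^-1 * - be i <= (1 + s)^-1 * `|be i|.
  by rewrite ler_wpM2l // invr_ge0; lra.
by rewrite mulrN; lra.
Qed.

(** * Interior points of a convex cone *)

(** If one can leave [y] a little in the direction opposite to each of finitely
    many spanning elements [q j] of the cone, then [y] is an interior point:
    every [z] near [y] is [y] plus a combination of the [q j] with small
    coefficients, hence an average of points [y + s *: q j] of the cone. *)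
Lemma interior_cone (R : realType) k m (C : set 'rV[R]_k) (y : 'rV[R]_k)
    (q : 'I_m -> 'rV[R]_k) :
  (forall a b x z, 0 <= a -> 0 <= b -> C x -> C z -> C (a *: x + b *: z)) ->
  C y -> (forall j, C (q j)) ->
  (forall j, exists2 e : R, 0 < e & C (y - e *: q j)) ->
  (forall l : 'cV[R]_k, (forall j, q j *m l = 0) -> l = 0) ->
  interior C y.
Proof.
move=> Cc Cy Cq Ce qspan.
pose Q := \matrix_(j < m) q j.
have Qfull : row_full Q.
  rewrite -cokermx_eq0; apply/eqP/matrixP => i j.
  have /(congr1 (fun M : 'cV_k => M i 0)) : col j (cokermx Q) = 0.
    apply: qspan => j'; have -> : q j' = row j' Q by rewrite rowK.
    by rewrite colE mulmxA -row_mul mulmx_coker row0 mul0mx.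
  by rewrite !mxE.
have [e e0 Ce'] : exists2 e : R, 0 < e & forall j, C (y - e *: q j).
  have [e eP] : {e : 'I_m -> R & forall j, 0 < e j /\ C (y - e j *: q j)}.
    apply: (@choice _ _ (fun j e => 0 < e /\ C (y - e *: q j))) => j.
    by have [e] := Ce j; exists e.
  have [e1 e10 ee] := @small_step R 'I_m predT e (fun=> -1) (fun j _ => (eP j).1).
  exists e1 => // j; have := ee j isT; rewrite mulrN1 => e1j.
  have -> : y - e1 *: q j = 1 *: (y - e j *: q j) + (e j - e1) *: q j.
    by rewrite scale1r scalerBl addrA subrK.
  by apply: Cc => //; [lra|exact: (eP j).2].
have Csum (I : Type) (r : seq I) (z : I -> 'rV[R]_k) (d : R) :
    0 <= d -> (forall j, C (z j)) -> C (d *: y + \sum_(j <- r) d *: z j).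
  move=> d0 Cz; elim: r => [|j r IH].
    by rewrite big_nil -[0](scale0r y); apply: Cc.
  by rewrite big_cons addrCA -[_ + \sum_(_ <- _) _]scale1r; apply: Cc.
pose s (z : 'rV[R]_k) j := ((z - y) *m pinvmx Q) 0 j.
have sE z : z = y + \sum_j s z j *: q j.
  rewrite [LHS](_ : z = y + (z - y)); last by rewrite addrC subrK.
  congr (_ + _); rewrite -[LHS]mulmx1 -(mulVpmx Qfull) mulmxA mulmx_sum_row.
  by apply: eq_bigr => j _; rewrite rowK.
(* Averaging [m.+1] points requires [m.+1] times the coefficient in each. *)
pose d := e / m.+1%:R.
have d0 : 0 < d by rewrite divr_gt0.
suff : \forall z \near y, forall j, `|s z j| < d.
  apply: filterS => z sd; rewrite (sE z).
  have cc0 : 0 < m.+1%:R^-1 :> R by rewrite invr_gt0.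
  have Cd j : C (y + (m.+1%:R * s z j) *: q j).
    have -> : y + (m.+1%:R * s z j) *: q j =
       1 *: (y - e *: q j) + (e + m.+1%:R * s z j) *: q j.
      by rewrite scale1r scalerDl addrA subrK.
    apply: Cc => //; have := sd j; rewrite /d ltr_pdivlMr // => h.
    have := ler_norm (- s z j); rewrite normrN => h2.
    have : - s z j * m.+1%:R <= `|s z j| * m.+1%:R by rewrite ler_wpM2r.
    by rewrite mulNr mulrC; lra.
  have := @Csum 'I_m (index_enum 'I_m) _ _ (ltW cc0) Cd.
  congr C; under eq_bigr do rewrite scalerDr scalerA mulrA mulVf ?pnatr_eq0 // mul1r.
  rewrite big_split /= sumr_const card_ord addrA; congr (_ + _).
  by rewrite -mulrS -[_ *+ m.+1]scaler_nat scalerA mulfV ?pnatr_eq0 // scale1r.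
apply: (@filter_forall _ _ (fun j z => `|s z j| < d) (nbhs y) _) => j.
have sc : s ^~ j @ y --> (0 : R).
  have -> : (0 : R) = s y j by rewrite /s subrr mul0mx mxE.
  have -> : s ^~ j = (fun z => \sum_(i < k) (z 0 i - y 0 i) * pinvmx Q i j).
    by apply/funext => z; rewrite /s mxE; apply: eq_bigr => i _; rewrite !mxE.
  have -> : s y j = \sum_(i < k) (y 0 i - y 0 i) * pinvmx Q i j.
    by rewrite /s mxE; apply: eq_bigr => i _; rewrite !mxE.
  apply: (@cvg_big _ _ _ _ xpredT add_continuous _ (nbhs y) _ _ _ _) => i _.
  apply: cvgM; last exact: cvg_cst.
  by apply: cvgB; [exact: coord_continuous|exact: cvg_cst].
by have /cvgr0Pnorm_lt := sc; apply.
Qed.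

(** * Finite-dimensional spaces of functions *)

Section FunctionSpace.
Context {R : realType} {X : Type} (V : set (X -> R)).
Hypothesis Vfd : exists k (f : 'I_k -> X -> R), basis_of V f.

(** There is no addition on the points of a complex: that [x] is the combination
    of the points [p i] with coefficients [c i] is tested by the functions of
    [V], which play the role of coordinates. *)
Definition lincomb (I : finType) (x : X) (c : I -> R) (p : I -> X) : Prop :=
  forall u, V u -> u x = \sum_i c i * u (p i).

Lemma chart_fun k (f : 'I_k -> X -> R) : basis_of V f -> forall l : 'cV[R]_k,
  V (fun x => (chart f x *m l) 0 0).
Proof.
move=> [_ ->] l; exists l^T => //; apply/funext => x; rewrite mxE.
by apply: eq_bigr => i _; rewrite !mxE mulrC.
Qed.

Lemma chart_funP k (f : 'I_k -> X -> R) u : basis_of V f -> V u ->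
  exists l : 'cV[R]_k, forall x, u x = (chart f x *m l) 0 0.
Proof.
move=> [_ ->] [l _ <-]; exists l^T => x; rewrite mxE.
by apply: eq_bigr => i _; rewrite !mxE mulrC.
Qed.

Lemma basis_fun k (f : 'I_k -> X -> R) i : basis_of V f -> V (f i).
Proof.
move=> [_ ->]; exists (delta_mx 0 i) => //; apply/funext => x.
rewrite (bigD1 i) //= mxE !eqxx mul1r big1 ?addr0 // => j /negPf ji.
by rewrite mxE ji andbF mul0r.
Qed.

Lemma linear_fun_lin r u u' : V u -> V u' -> V (fun x => r * u x + u' x).
Proof.
have [k [f fb]] := Vfd.
move=> /(chart_funP fb)[l ul] /(chart_funP fb)[l' ul'].
have := chart_fun fb (r *: l + l'); congr V; apply/funext => x.
by rewrite mulmxDr -scalemxAr !mxE ul ul' !mxE.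
Qed.

Lemma linear_fun0 : V (fun=> 0).
Proof.
have [k [f fb]] := Vfd; have := chart_fun fb 0; congr V; apply/funext => x.
by rewrite mulmx0 mxE.
Qed.

Lemma linear_fun_sum (I : Type) (s : seq I) (P : pred I) (r : I -> R) u :
  (forall i, P i -> V (u i)) -> V (fun x => \sum_(i <- s | P i) r i * u i x).
Proof.
move=> Vu; elim: s => [|i s IH].
  by have := linear_fun0; congr V; apply/funext => x; rewrite big_nil.
have [Pi|Pi] := boolP (P i); last first.
  by move: IH; congr V; apply/funext => x; rewrite big_cons (negPf Pi).
have := linear_fun_lin (r i) (Vu i Pi) IH; congr V; apply/funext => x.
by rewrite big_cons Pi.
Qed.

Lemma linear_funZ r u : V u -> V (fun x => r * u x).
Proof. by move=> Vu; have := linear_fun_lin r Vu linear_fun0; under eq_fun do rewrite addr0. Qed.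

Lemma linear_funD u u' : V u -> V u' -> V (fun x => u x + u' x).
Proof. by move=> Vu Vu'; have := linear_fun_lin 1 Vu Vu'; under eq_fun do rewrite mul1r. Qed.

Lemma linear_funB u u' : V u -> V u' -> V (fun x => u x - u' x).
Proof.
move=> Vu Vu'; have := linear_fun_lin (-1) Vu' Vu.
by under eq_fun do rewrite mulN1r addrC.
Qed.

Lemma lincomb_chart k (f : 'I_k -> X -> R) (I : finType) x (c : I -> R) p :
  basis_of V f ->
  lincomb x c p <-> chart f x = \sum_i c i *: chart f (p i).
Proof.
move=> fb; split => [xcp|xcp u /(chart_funP fb)[l ul]].
  by apply/rowP => j; rewrite mxE (xcp _ (basis_fun j fb)) summxE; apply: eq_bigr => i _; rewrite !mxE.
rewrite ul xcp mulmx_suml summxE; apply: eq_bigr => i _.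
by rewrite -scalemxAl mxE ul.
Qed.

Definition separated (T : set X) : Prop :=
  forall x y, T x -> T y -> (forall u, V u -> u x = u y) -> x = y.

Lemma separated_chart k (f : 'I_k -> X -> R) T x y : basis_of V f ->
  separated T -> T x -> T y -> chart f x = chart f y -> x = y.
Proof.
by move=> fb sT Tx Ty e; apply: sT => // u /(chart_funP fb)[l ul]; rewrite !ul e.
Qed.

(** Supporting hyperplanes in a chart are the same thing as functions in [V],
    whatever basis of [V] is chosen; this removes the charts from faces. *)
Lemma face_inP T F : separated T -> face_in V T F <->
  exists2 u, V u & (forall x, T x -> 0 <= u x) /\ F = T `&` [set x | u x = 0].
Proof.
move=> sT; split.
  move=> [FT [k [f [fb [l lT FE]]]]].
  exists (fun x => (chart f x *m l) 0 0); first exact: chart_fun.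
  split=> [x Tx|]; first by apply: lT; exists x.
  apply/seteqP; split => x.
    move=> Fx; split; first exact: FT.
    have : (chart f @` F) (chart f x) by exists x.
    by rewrite FE => -[_ /= ->]; rewrite mxE.
  move=> [Tx /= ux]; have : (chart f @` F) (chart f x).
    rewrite FE; split; first by exists x.
    by apply/matrixP => i j; rewrite !ord1 ux mxE.
  move=> [y Fy yx]; have <- // := separated_chart fb sT (FT _ Fy) Tx yx.
move=> [u Vu [u0 ->]]; split; first by move=> x [].
have [k [f fb]] := Vfd; exists k, f; split => //.
have [l ul] := chart_funP fb Vu.
exists l => [_ [x Tx <-]|]; first by rewrite -ul; apply: u0.
apply/seteqP; split.
  move=> _ [x [Tx /= ux] <-]; split; first by exists x.
  by apply/matrixP => i j; rewrite !ord1 -ul ux mxE.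
move=> _ [[x Tx <-] /= xl]; exists x => //; split => //=.
by rewrite ul xl mxE.
Qed.

(** Farkas' lemma for evaluations at points.  The signs allow for constraints
    [u (p i) <= 0], which are not evaluations at points of the cell. *)
Lemma farkas_points_signed (I : finType) (s : I -> R) (p : I -> X) (r : R) x :
  (forall u, V u -> (forall i, 0 <= s i * u (p i)) -> 0 <= r * u x) ->
  exists2 c : I -> R, (forall i, 0 <= c i)
    & forall u, V u -> r * u x = \sum_i c i * (s i * u (p i)).
Proof.
have [k [f fb]] := Vfd => H.
have ev y t : functional (fun l : 'cV[R]_k => t * (chart f y *m l) 0 0).
  by move=> r' l l'; rewrite mulmxDr -scalemxAr !mxE; ring.
have [l lp|c c0 gE] := @farkas_fin R 'cV[R]_k I
  (fun i l => s i * (chart f (p i) *m l) 0 0)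
   (fun l => r * (chart f x *m l) 0 0) (fun i => ev _ _) (ev _ _).
  exact: (H _ (chart_fun fb l)).
exists c => // u /(chart_funP fb)[l ul]; rewrite ul gE.
by apply: eq_bigr => i _; rewrite ul.
Qed.

Lemma farkas_points (I : finType) (p : I -> X) x :
  (forall u, V u -> (forall i, 0 <= u (p i)) -> 0 <= u x) ->
  exists2 c : I -> R, (forall i, 0 <= c i) & lincomb x c p.
Proof.
move=> H; have [u Vu up|c c0 cE] := @farkas_points_signed I (fun=> 1) p 1 x.
  by rewrite mul1r; apply: H => // i; rewrite -[u _]mul1r.
exists c => // u Vu; have := cE u Vu; rewrite mul1r => ->.
by apply: eq_bigr => i _; rewrite mul1r.
Qed.

End FunctionSpace.
Arguments lincomb {R X} V {I} x c p.

(** * Cells and their faces *)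

Section Cells.
Context {R : realType} {S : conicalComplex R}.
Implicit Types (a b d : cell S) (x y z : S) (T F : set S).
Local Notation V a := (linear_fun a).

Lemma origin_cone a : cone a (origin S).
Proof. exact: (originP a).1. Qed.

Lemma origin_val a u : V a u -> u (origin S) = 0.
Proof. exact: (originP a).2. Qed.

Lemma cell_separated a : separated (V a) (cone a).
Proof.
have [k [f fb]] := linear_fun_findim a; have [C [[_ _ [g _ gK]] _ _ _]] := cone_chart fb.
move=> x y ax ay e; rewrite -(gK x) ?inE // -(gK y) ?inE //; congr g.
by apply/rowP => i; rewrite !mxE; apply: e; exact: basis_fun.
Qed.

Lemma cell_faceP a T F : T `<=` cone a -> face_in (V a) T F <->
  exists2 u, V a u & (forall x, T x -> 0 <= u x) /\ F = T `&` [set x | u x = 0].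
Proof.
move=> aT; apply: face_inP; first exact: linear_fun_findim.
by move=> x y /aT ax /aT ay; exact: cell_separated.
Qed.

Lemma conic_hull_gen k m (t : 'I_m -> 'rV[R]_k) i : conic_hull t (t i).
Proof.
exists (fun j => (i == j)%:R) => [j|]; first exact: ler0n.
rewrite (bigD1 i) //= eqxx scale1r big1 ?addr0 // => j.
by rewrite eq_sym => /negPf ->; rewrite scale0r.
Qed.

Lemma chart_conic_hull a k (f : 'I_k -> S -> R) : basis_of (V a) f ->
  exists m (p : 'I_m -> S), (forall i, cone a (p i)) /\
    chart f @` cone a = conic_hull (fun i => chart f (p i)).
Proof.
move=> fb; have [C [[_ CE _] [m [v vE]] _ _]] := cone_chart fb.
have pE i : exists y, cone a y /\ chart f y = v i.
  have : C (v i) by rewrite vE; exact: conic_hull_gen.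
  by rewrite -CE => -[y ay yv]; exists y.
have {pE}[p pP] := choice pE.
exists m, p; split=> [i|]; first exact: (pP i).1.
by rewrite CE vE; congr conic_hull; apply/funext => i; rewrite (pP i).2.
Qed.

Lemma cell_generated a : exists m (p : 'I_m -> S), (forall i, cone a (p i)) /\
  forall x, cone a x -> exists2 c, (forall i, 0 <= c i) & lincomb (V a) x c p.
Proof.
have [k [f fb]] := linear_fun_findim a; have [m [p [ap hE]]] := chart_conic_hull fb.
exists m, p; split => // x ax.
have : (chart f @` cone a) (chart f x) by exists x.
by rewrite hE => -[c c0 cE]; exists c => //; apply/(lincomb_chart _ _ _ fb).
Qed.

Lemma cell_conic_closed a (I : finType) (c : I -> R) (p : I -> S) :
  (forall i, 0 <= c i) -> (forall i, cone a (p i)) ->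
  exists2 x, cone a x & lincomb (V a) x c p.
Proof.
move=> c0 ap.
have [k [f fb]] := linear_fun_findim a; have [m [q [aq hE]]] := chart_conic_hull fb.
have H i : exists e, (forall j, 0 <= e j) /\ chart f (p i) = \sum_j e j *: chart f (q j).
  have : (chart f @` cone a) (chart f (p i)) by exists (p i).
  by rewrite hE => -[e]; exists e.
have {H}[e eP] := choice H.
have : (chart f @` cone a) (\sum_i c i *: chart f (p i)).
  rewrite hE; exists (fun j => \sum_i c i * e i j).
    by move=> j; apply: sumr_ge0 => i _; rewrite mulr_ge0 // (eP i).1.
  under [RHS]eq_bigr do rewrite scaler_suml.
  rewrite exchange_big /=; apply: eq_bigr => i _.
  by rewrite (eP i).2 scaler_sumr; apply: eq_bigr => j _; rewrite scalerA.
by move=> [x ax xE]; exists x => //; apply/(lincomb_chart _ _ _ fb).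
Qed.

(** Strict convexity of the cells, without charts. *)
Lemma cell_pointed a x y : cone a x -> cone a y ->
  (forall u, V a u -> u x + u y = 0) -> x = origin S.
Proof.
move=> ax ay xy; apply: (@cell_separated a) => // [|u Vu]; first exact: origin_cone.
have [k [f fb]] := linear_fun_findim a; have [C [[_ CE _] _ Cs _]] := cone_chart fb.
have [l ul] := chart_funP fb Vu.
rewrite (origin_val Vu) ul (Cs (chart f x)) ?mul0mx ?mxE // -CE.
  by exists x.
exists y => //; apply/rowP => i; rewrite !mxE; apply/eqP.
by rewrite -addr_eq0 addrC; apply/eqP/xy; exact: basis_fun.
Qed.

Lemma cell_scale a r x : 0 <= r -> cone a x ->
  exists2 y, cone a y & forall u, V a u -> u y = r * u x.
Proof.
move=> r0 ax; have [y ay yE] := @cell_conic_closed a unit (fun=> r) (fun=> x) (fun=> r0) (fun=> ax).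
by exists y => // u /yE ->; rewrite big_const card_unit /= addr0.
Qed.

(** [subcell d a] says that [d] is a face of [a], including the compatibility of
    the linear functions, which [face_of] does not mention. *)
Definition subcell d a : Prop :=
  (exists m, [/\ V a m, forall x, cone a x -> 0 <= m x
     & cone d = cone a `&` [set x | m x = 0]]) /\
  V d = [set u \_ (cone d) | u in V a].

Lemma subcell_sub d a : subcell d a -> cone d `<=` cone a.
Proof. by move=> [[m [_ _ ->]] _] x []. Qed.

Lemma subcell_fun d a u : subcell d a -> V a u ->
  exists2 u', V d u' & forall x, cone d x -> u' x = u x.
Proof.
move=> [_ Vd] Vu; exists (u \_ (cone d)); first by rewrite Vd; exists u.
by move=> x dx; rewrite patchT ?inE.
Qed.

Lemma subcell_ext d a u : subcell d a -> V d u ->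
  exists2 u', V a u' & forall x, cone d x -> u x = u' x.
Proof.
move=> [_ ->] [u' Vu' <-]; exists u' => // x dx.
by rewrite patchT ?inE.
Qed.

Lemma subcell_lincomb_supp d a (I : finType) x (c : I -> R) p : subcell d a ->
  cone d x -> (forall i, c i != 0 -> cone d (p i)) ->
  lincomb (V d) x c p <-> lincomb (V a) x c p.
Proof.
move=> da dx dp; split=> xp u.
  move=> /(subcell_fun da)[u' Vu' uu']; rewrite -uu' // xp //.
  apply: eq_bigr => i _; have [->|/dp ci] := eqVneq (c i) 0; first by rewrite !mul0r.
  by rewrite uu'.
move=> /(subcell_ext da)[u' Vu' uu']; rewrite uu' // xp //.
apply: eq_bigr => i _; have [->|/dp ci] := eqVneq (c i) 0; first by rewrite !mul0r.
by rewrite uu'.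
Qed.

Lemma subcell_lincomb d a (I : finType) x (c : I -> R) p : subcell d a ->
  cone d x -> (forall i, cone d (p i)) ->
  lincomb (V d) x c p <-> lincomb (V a) x c p.
Proof. by move=> da dx dp; exact: subcell_lincomb_supp. Qed.

Lemma subcell_face_of d a : subcell d a -> face_of d a.
Proof.
move=> [[m [Vm m0 dE]] _]; by apply/cell_faceP => //; exists m.
Qed.

(** A supporting function of the face vanishes on [x] and is nonnegative on the
    points combined, hence vanishes at each of those that really occur. *)
Lemma subcell_supp d a (I : finType) x (c : I -> R) p i : subcell d a ->
  cone d x -> (forall i, 0 <= c i) -> (forall i, c i != 0 -> cone a (p i)) ->
  lincomb (V a) x c p -> c i != 0 -> cone d (p i).
Proof.
move=> [[m [Vm m0 dE]] _] dx c0 ap xp ci; rewrite dE; split; first exact: ap.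
have : m x = 0 by move: dx; rewrite dE => -[].
rewrite (xp m Vm) => /eqP; rewrite psumr_eq0; last first.
  move=> j _; have [->|cj] := eqVneq (c j) 0; first by rewrite mul0r.
  by rewrite mulr_ge0 // m0 //; exact: ap.
move=> /allP /(_ i); rewrite mem_index_enum => /(_ isT) /=.
by rewrite mulf_eq0 (negPf ci) => /eqP.
Qed.

(** The face is cut out by the sum [M] of one supporting function through [x] for
    each generator of the cell on which some such function is positive.  By
    Farkas' lemma, a generator [p j] that stays on the face can be subtracted a
    little from [x] without leaving the cell, and these generators span the
    linear functions on the face; so [x] is an interior point of the face. *)
Lemma minimal_face a x : cone a x ->
  exists d, subcell d a /\ relint_in (V d) (cone d) x.
Proof.
move=> ax; have [m [p [ap pgen]]] := cell_generated a.
pose P i u := [/\ V a u, forall y, cone a y -> 0 <= u y, u x = 0 & 0 < u (p i)].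
have H i : exists u, ((exists u, P i u) -> P i u) /\
    [/\ V a u, forall y, cone a y -> 0 <= u y & u x = 0].
  have [[u Pu]|nP] := pselect (exists u, P i u).
    by exists u; split => //; case: Pu.
  by exists (fun=> 0); split => //; split => //; apply: linear_fun0; exact: linear_fun_findim.
have {H}[U UP] := choice H.
pose M y := \sum_i 1 * U i y.
have VM : V a M by apply: linear_fun_sum; [exact: linear_fun_findim|move=> i _; case: (UP i).2].
have M0 y : cone a y -> 0 <= M y.
  by move=> ay; apply: sumr_ge0 => i _; rewrite mul1r; case: (UP i).2 => _ ->.
have Mx : M x = 0.
  by rewrite /M big1 // => i _; rewrite mul1r; case: (UP i).2.
have Mp i : (exists u, P i u) -> M (p i) != 0.
  move=> /(UP i).1[_ _ _ Ui]; rewrite gt_eqF // /M (bigD1 i) //= mul1r.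
  apply: ltr_wpDr => //; apply: sumr_ge0 => j _; rewrite mul1r.
  by case: (UP j).2 => _ ->.
have [|d [dE Vd]] := @cone_face _ S a (cone a `&` [set y | M y = 0]).
  by apply/cell_faceP => //; exists M.
have da : subcell d a by split => //; exists M.
exists d; split => //.
have dx : cone d x by rewrite dE.
split => //; have [k [f fb]] := linear_fun_findim d; exists k, f; split => //.
(* The generators off the face are replaced by the origin. *)
pose q i := if pselect (cone d (p i)) then p i else origin S.
have dq i : cone d (q i) by rewrite /q; case: (pselect (cone d (p i))) => [//|n]; exact: origin_cone.
apply: (@interior_cone R k m _ _ (fun i => chart f (q i))).
- move=> r s y' z' r0 s0 [y dy <-] [z dz <-].
  have [||w dw wE] := @cell_conic_closed d bool (fun o => if o then r else s)
    (fun o => if o then y else z); [by case|by case|].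
  exists w => //; have /(lincomb_chart _ _ _ fb) -> := wE.
  by rewrite big_bool.
- by exists x.
- by move=> j; exists (q j).
- move=> j; rewrite /q; case: (pselect (cone d (p j))) => [dp|dp] /=; last first.
    exists 1 => //; exists x => //; apply/rowP => i; rewrite !mxE.
    by rewrite (origin_val (basis_fun i fb)) mulr0 subr0.
  have nP u : V a u -> (forall y, cone a y -> 0 <= u y) -> u x = 0 -> u (p j) <= 0.
    move=> Vu u0 ux; rewrite leNgt; apply/negP => uj.
    suff /Mp /eqP : exists u, P j u by apply; move: dp; rewrite dE => -[].
    by exists u.
  (* The index [None] stands for the constraint [u x <= 0]. *)
  pose I := option 'I_m.
  have [u Vu up|c c0 cE] := @farkas_points_signed _ _ (V a) (linear_fun_findim a) I
    (fun i => if i is Some _ then 1 else -1) (fun i => if i is Some i then p i else x) (-1) (p j).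
    rewrite mulN1r oppr_ge0; apply: nP => // [y ay|].
      have [c c0 ->//] := pgen y ay.
      by apply: sumr_ge0 => i _; rewrite mulr_ge0 //; have := up (Some i); rewrite mul1r.
    have := up None; have [c c0 -> //] := pgen x ax.
    have : 0 <= \sum_i c i * u (p i).
      by apply: sumr_ge0 => i _; rewrite mulr_ge0 //; have := up (Some i); rewrite mul1r.
    lra.
  (* A positive multiple of [x] is [p j] plus an element of the cell. *)
  have {cE}cE u : V a u -> u (p j) + \sum_i c (Some i) * u (p i) = c None * u x.
    by move=> /cE; rewrite sum_option /=; under eq_bigr do rewrite mul1r; lra.
  have [cN|cN] := eqVneq (c None) 0.
    have [y ay yE] := cell_conic_closed (fun i => c0 (Some i)) ap.
    have -> : p j = origin S.
      by apply: (@cell_pointed a _ y) => // u Vu; rewrite (yE u Vu) cE // cN mul0r.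
    exists 1 => //; exists x => //; apply/rowP => i; rewrite !mxE.
    by rewrite (origin_val (basis_fun i fb)) mulr0 subr0.
  have cN0 : 0 < c None by rewrite lt0r cN c0.
  have [y ay yE] := @cell_conic_closed a _ (fun i => c (Some i) / c None) p
    (fun i => divr_ge0 (c0 _) (c0 _)) ap.
  have {}yE u : V a u -> u y = u x - (c None)^-1 * u (p j).
    move=> Vu; rewrite yE //; under eq_bigr do rewrite mulrAC.
    rewrite -mulr_suml -[\sum_i _](addKr (u (p j))) cE //; field.
    by rewrite cN.
  have dy : cone d y.
    rewrite dE; split => //=; rewrite yE // Mx.
    by move: dp; rewrite dE => -[_ /= ->]; rewrite mulr0 subr0.
  exists (c None)^-1; first by rewrite invr_gt0.
  exists y => //; apply/rowP => i; rewrite !mxE.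
  have [u Vu uE] := subcell_ext da (basis_fun i fb).
  by rewrite !uE // yE.
move=> l ql.
have Vl := chart_fun fb l.
suff l0 z : (chart f z *m l) 0 0 = 0.
  have [fi _] := fb; apply: trmx_inj; apply: fi; apply/funext => z.
  have := l0 z; rewrite mxE => h; rewrite trmx0.
  under [RHS]eq_bigr do rewrite mxE mul0r.
  rewrite [RHS]big1 // -[RHS]h; apply: eq_bigr => i _.
  by rewrite !mxE mulrC.
have [dz|dz] := pselect (cone d z); last exact: (linear_fun_out Vl dz).
have [c c0 cz] := pgen z (subcell_sub da dz).
have [u Vu uE] := subcell_ext da Vl.
rewrite (uE z dz) (cz u Vu) big1 // => i _.
have [->|ci] := eqVneq (c i) 0; first by rewrite mul0r.
have dpi : cone d (p i) by apply: (subcell_supp da dz c0 _ cz ci) => *; exact: ap.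
rewrite -uE //; have := ql i; rewrite /q; case: (pselect (cone d (p i))) => // dp' ->.
by rewrite mxE mulr0.
Qed.

Definition relint_cell x : cell S := sval (cid (cone_partition x)).

Lemma relint_cellP x : relint_in (V (relint_cell x)) (cone (relint_cell x)) x.
Proof. by case: (svalP (cid (cone_partition x))). Qed.

Lemma relint_cell_unique x d : relint_in (V d) (cone d) x -> relint_cell x = d.
Proof. by case: (svalP (cid (cone_partition x))) => _; apply. Qed.

Lemma relint_cell_cone x : cone (relint_cell x) x.
Proof. by case: (relint_cellP x). Qed.

(** The minimal face of [a] through [x] has [x] in its relative interior, and
    there is only one such cell; so it does not depend on [a]. *)
Lemma relint_cell_subcell a x : cone a x -> subcell (relint_cell x) a.
Proof. by move=> /minimal_face[d [da /relint_cell_unique ->]]. Qed.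

(** The sum of a finite set of generators is in no proper face.  The minimal face
    containing it is thus a cell [d] with the same cone as [b]; then [d] and [b]
    have the same linear functions and the same relative interior. *)
Lemma cell_relint_point b : exists x, relint_cell x = b.
Proof.
have [m [p [bp pgen]]] := cell_generated b.
have [x bx xE] := @cell_conic_closed b _ (fun=> 1) p (fun=> ler01) bp.
have db := relint_cell_subcell bx.
have dE : cone (relint_cell x) = cone b.
  apply/seteqP; split; first exact: subcell_sub.
  move=> y by_; have [c c0 cE] := pgen y by_.
  have dp i : cone (relint_cell x) (p i).
    by apply: (subcell_supp db (relint_cell_cone x) (fun=> ler01) _ xE); rewrite ?oner_neq0.
  have [z dz zE] := cell_conic_closed c0 dp.
  have <- // : z = y.
  apply: (@cell_separated b) => //; first exact: (subcell_sub db).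
  by move=> u Vu; rewrite (cE u Vu); have /(subcell_lincomb _ db) -> := zE.
exists x; apply: relint_cell_unique; have := relint_cellP x; rewrite dE.
have -> // : V (relint_cell x) = V b.
have [_ ->] := db; rewrite dE; apply/seteqP; split => [_ [u Vu <-]|u Vu].
  have -> // : u \_ (cone b) = u.
  by apply/funext => y; rewrite patchE; case: ifPn => // /negP; rewrite inE => /(linear_fun_out Vu).
exists u => //.
by apply/funext => y; rewrite patchE; case: ifPn => // /negP; rewrite inE => /(linear_fun_out Vu).
Qed.

(** Inclusion of cones implies being a face: a relative interior point of [b]
    determines [b] as its minimal face in [a]. *)
Lemma cone_subcell b a : cone b `<=` cone a -> subcell b a.
Proof. by have [x <-] := cell_relint_point b => sub; apply/relint_cell_subcell/sub/relint_cell_cone. Qed.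

End Cells.

(** * Convex hulls and rays in a cell *)

Section Hulls.
Context {R : realType} {S : conicalComplex R}.
Implicit Types (a b d : cell S) (x y z : S) (T F : set S).
Local Notation V a := (linear_fun a).

Definition hull a (I : finType) (p : I -> S) : set S :=
  [set x | cone a x /\ exists2 c, (forall i, 0 <= c i) & lincomb (V a) x c p].

Lemma hull_sub a (I : finType) (p : I -> S) : hull a p `<=` cone a.
Proof. by move=> x []. Qed.

Lemma hull_gen a (I : finType) (p : I -> S) i : cone a (p i) -> hull a p (p i).
Proof.
move=> ap; split => //; exists (fun j => (i == j)%:R) => [j|u Vu]; first exact: ler0n.
rewrite (bigD1 i) //= eqxx mul1r big1 ?addr0 // => j.
by rewrite eq_sym => /negPf ->; rewrite mul0r.
Qed.

Lemma hull_trans a (I J : finType) (p : I -> S) (q : J -> S) :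
  (forall j, hull a p (q j)) -> hull a q `<=` hull a p.
Proof.
move=> pq x [ax [c c0 xc]]; split => //.
have H j : exists e, (forall i, 0 <= e i) /\ lincomb (V a) (q j) e p.
  by have [_ [e]] := pq j; exists e.
have {H}[e eP] := choice H.
exists (fun i => \sum_j c j * e j i) => [i|u Vu].
  by apply: sumr_ge0 => j _; rewrite mulr_ge0 //; have [] := eP j.
rewrite (xc u Vu); under [RHS]eq_bigr do rewrite mulr_suml.
rewrite exchange_big /=; apply: eq_bigr => j _.
by rewrite ((eP j).2 u Vu) mulr_sumr; apply: eq_bigr => i _; rewrite mulrA.
Qed.

Lemma hull_origin a (I : finType) (p : I -> S) : hull a p (origin S).
Proof.
split; first exact: origin_cone.
exists (fun=> 0) => // u Vu; rewrite (origin_val Vu) big1 // => i _.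
by rewrite mul0r.
Qed.

Lemma hull_subcell d a (I : finType) (p : I -> S) : subcell d a ->
  (forall i, cone d (p i)) -> hull d p = hull a p.
Proof.
move=> da dp; apply/seteqP; split => x [dx [c c0 xc]].
  split; first exact: (subcell_sub da).
  by exists c => //; apply/(subcell_lincomb _ da).
have [y dy yc] := cell_conic_closed c0 dp.
have <- : y = x.
  apply: (@cell_separated _ _ a) => //; first exact: (subcell_sub da).
  by move=> u Vu; rewrite xc //; have /(subcell_lincomb _ da) -> := yc.
by split => //; exists c.
Qed.

(** A cone contained in two cells lies in a common face of them, namely in the
    cell of the sum of its generators. *)
Lemma hull_local a b (I : finType) (p : I -> S) :
  (forall i, cone b (p i)) -> hull b p `<=` cone a ->
  exists d, [/\ subcell d a, subcell d b & forall i, cone d (p i)].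
Proof.
move=> bp sub; have [x bx xc] := cell_conic_closed (fun i => @ler01 R) bp.
have ax : cone a x by apply: sub; split => //; exists (fun=> 1).
exists (relint_cell x); split; [exact: relint_cell_subcell|exact: relint_cell_subcell|] => i.
by apply: (subcell_supp (relint_cell_subcell bx) (relint_cell_cone x) _ _ xc); rewrite ?oner_neq0 // => *; exact: ler01.
Qed.

Lemma hull_transfer a b (I : finType) (p : I -> S) :
  (forall i, cone b (p i)) -> hull b p `<=` cone a ->
  (forall i, cone a (p i)) /\ hull b p = hull a p.
Proof.
move=> bp sub; have [d [da db dp]] := hull_local bp sub.
split; first by move=> i; exact: (subcell_sub da).
by rewrite -(hull_subcell db) // (hull_subcell da).
Qed.

Lemma chart_hull a k (f : 'I_k -> S -> R) m (p : 'I_m -> S) :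
  basis_of (V a) f -> (forall i, cone a (p i)) ->
  chart f @` hull a p = conic_hull (fun i => chart f (p i)).
Proof.
move=> fb ap; apply/seteqP; split.
  by move=> _ [x [_ [c c0 /(lincomb_chart _ _ _ fb) xc]] <-]; exists c.
move=> _ [c c0 ->]; have [x ax xc] := cell_conic_closed c0 ap.
exists x; last exact/(lincomb_chart _ _ _ fb).
by split => //; exists c.
Qed.

Lemma chart_hullP a k (f : 'I_k -> S -> R) m (p : 'I_m -> S) T :
  basis_of (V a) f -> (forall i, cone a (p i)) -> T `<=` cone a ->
  chart f @` T = conic_hull (fun i => chart f (p i)) -> T = hull a p.
Proof.
move=> fb ap aT; rewrite -(chart_hull fb ap) => E.
have sub A B : A `<=` cone a -> B `<=` cone a -> chart f @` A = chart f @` B -> A `<=` B.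
  move=> aA aB AB x Ax; have : (chart f @` A) (chart f x) by exists x.
  rewrite AB => -[y By yx].
  by rewrite -(separated_chart fb (@cell_separated _ _ a) (aB _ By) (aA _ Ax) yx).
by apply/seteqP; split; apply: sub => //; exact: hull_sub.
Qed.

Lemma chart_conic_hullP a k (f : 'I_k -> S -> R) m (v : 'I_m -> 'rV[R]_k) T :
  basis_of (V a) f -> T `<=` cone a -> chart f @` T = conic_hull v ->
  exists p, [/\ forall i, cone a (p i), forall i, chart f (p i) = v i & T = hull a p].
Proof.
move=> fb aT Tv.
have H i : exists y, cone a y /\ chart f y = v i.
  have : (chart f @` T) (v i) by rewrite Tv; exact: conic_hull_gen.
  by move=> [y Ty yv]; exists y; split => //; exact: aT.
have {H}[p pP] := choice H.
have pv : (fun i => chart f (p i)) = v by apply/funext => i; rewrite (pP i).2.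
exists p; split => [i|i|]; [exact: (pP i).1|exact: (pP i).2|].
by apply: (chart_hullP fb) => //; [move=> i; exact: (pP i).1|rewrite pv].
Qed.

(** The cell is immaterial, by [ray_cell]; the one at hand makes the definition
    depend on [x] alone. *)
Definition ray x : set S := hull (relint_cell x) (fun _ : 'I_1 => x).

Lemma ray_cell a x : cone a x -> ray x = hull a (fun _ : 'I_1 => x).
Proof. by move=> ax; apply: hull_subcell => [|_]; [exact: relint_cell_subcell|exact: relint_cell_cone]. Qed.

Lemma rayP a x y : cone a x ->
  ray x y <-> cone a y /\ exists2 r, 0 <= r & forall u, V a u -> u y = r * u x.
Proof.
move=> ax; rewrite (ray_cell ax); split => -[ay].
  by move=> [c c0 yc]; split => //; exists (c ord0) => // u /yc ->; rewrite big_ord1.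
by move=> [r r0 yr]; split => //; exists (fun=> r) => // u /yr ->; rewrite big_ord1.
Qed.

Lemma ray_sub a x : cone a x -> ray x `<=` cone a.
Proof. by move=> ax y /(rayP _ ax)[]. Qed.

Lemma ray_refl x : ray x x.
Proof.
apply/(rayP _ (relint_cell_cone x)); split; first exact: relint_cell_cone.
by exists 1 => // u; rewrite mul1r.
Qed.

Lemma ray_pos a x y : cone a x -> y <> origin S -> ray x y ->
  exists2 r, 0 < r & forall u, V a u -> u y = r * u x.
Proof.
move=> ax yo /(rayP _ ax)[ay [r r0 yr]]; exists r => //.
rewrite lt0r r0 andbT; apply/eqP => r0'; apply: yo.
apply: (@cell_separated _ _ a) => //; first exact: origin_cone.
by move=> u Vu; rewrite (origin_val Vu) yr // r0' mul0r.
Qed.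

Lemma ray_eq x y : y <> origin S -> ray x y -> ray y = ray x.
Proof.
move=> yo xy; have ax := relint_cell_cone x; have ay : cone (relint_cell x) y := ray_sub ax xy.
have [r r0 yr] := ray_pos ax yo xy.
apply/seteqP; split => z /rayP; [move=> /(_ _ ay)|move=> /(_ _ ax)] => -[az [s s0 zs]]; apply/rayP.
- exact: ax.
- by split => //; exists (s * r) => [|u Vu]; [rewrite mulr_ge0 // ltW|rewrite zs // yr // mulrA].
- exact: ay.
- split => //; exists (s / r) => [|u Vu]; first by rewrite divr_ge0 // ltW.
  by rewrite zs // yr // mulrA divfK // gt_eqF.
Qed.

Lemma ray_edge x : x <> origin S -> is_edge (ray x).
Proof.
move=> xo; have ax := relint_cell_cone x; exists (relint_cell x); split; first exact: ray_sub.
have [k [f fb]] := linear_fun_findim (relint_cell x); exists k, f; split => //.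
exists (chart f x); split => [|i|].
- rewrite -row_leq_rank lt0n mxrank_eq0; apply/eqP => fx; apply: xo.
  apply: (@cell_separated _ _ (relint_cell x)) => //; first exact: origin_cone.
  by move=> u Vu; have [l ul] := chart_funP fb Vu; rewrite (origin_val Vu) ul fx mul0mx mxE.
- exists x; first exact: ray_refl.
  by apply/rowP => j; rewrite !mxE ?ord1.
- move=> _ [y /(rayP _ ax)[ay [r r0 yr]] <-]; apply/sub_rVP; exists r.
  by apply/rowP => i; rewrite !mxE yr //; exact: basis_fun.
Qed.

(** Every point of a one-dimensional cone is a multiple of a fixed [x]; a
    negative multiple would contradict strict convexity. *)
Lemma edge_ray b (I : finType) (p : I -> S) : (forall i, cone b (p i)) ->
  is_edge (hull b p) -> exists2 x, x <> origin S & hull b p = ray x.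
Proof.
move=> bp [a [sub [k [f [fb [A [Af AT TA]]]]]]].
have [ap E] := hull_transfer bp sub; rewrite E in AT TA *.
have [x xT xA] := AT ord0; have ax := hull_sub xT.
have {}xA : A = chart f x.
  by rewrite xA; apply/matrixP => i j; rewrite !mxE !ord1.
have xo : x <> origin S.
  move=> xo; move: Af; rewrite -row_leq_rank lt0n mxrank_eq0 => /eqP; apply.
  rewrite xA; apply/rowP => i; rewrite !mxE xo.
  by rewrite (origin_val (basis_fun i fb)).
exists x => //; apply/seteqP; split => [y yT|y].
  have ay := hull_sub yT; apply/(rayP _ ax); split => //.
  have : (chart f y <= A)%MS by apply: TA; exists y.
  rewrite xA => /sub_rVP[r yr].
  have {}yr u : V a u -> u y = r * u x.
    by move=> Vu; have [l ul] := chart_funP fb Vu; rewrite !ul yr -scalemxAl mxE.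
  have [r0|r0] := leP 0 r; first by exists r.
  have [z az zE] := @cell_scale _ _ a (- r) x ltac:(lra) ax.
  have yo : y = origin S.
    by apply: (cell_pointed ay az) => u Vu; rewrite yr // zE // mulNr subrr.
  by exists 0 => // u Vu; rewrite mul0r yo (origin_val Vu).
by rewrite (ray_cell ax); apply: hull_trans.
Qed.

Lemma edge_ray_point b (I : finType) (p : I -> S) x : (forall i, cone b (p i)) ->
  is_edge (hull b p) -> hull b p x -> x <> origin S -> hull b p = ray x.
Proof. by move=> bp eT + xo; have [y yo ->] := edge_ray bp eT => /(ray_eq xo) ->. Qed.

End Hulls.

(** * Generation by extreme rays *)

Section ExtremeRays.
Context {R : realType} {S : conicalComplex R}.
Implicit Types (a b d : cell S) (x y z : S) (T F : set S).
Local Notation V a := (linear_fun a).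

Definition extreme a x : Prop :=
  x <> origin S /\ exists2 b, subcell b a & cone b = ray x.

(** Take a minimal set [J] of generators.  For distinct [i] and [j] in [J] there
    is, by Farkas' lemma, a linear function that is nonnegative on [J], zero at
    [p j] and positive at [p i]: otherwise [p j] would be a combination of the
    other generators, or [p i] would be the origin.  The sum of these functions
    over [i] cuts out exactly the ray of [p j], which is thus a face. *)
Lemma cell_extreme_generated a : exists m (p : 'I_m -> S), (forall i, cone a (p i)) /\
  forall x, cone a x -> exists2 c, (forall i, 0 <= c i) &
    lincomb (V a) x c p /\ forall i, c i != 0 -> extreme a (p i).
Proof.
have [m [p [ap pgen]]] := cell_generated a.
pose P (J : {set 'I_m}) := `[< forall x, cone a x -> exists2 c, (forall i, 0 <= c i) &
  lincomb (V a) x c p /\ forall i, c i != 0 -> i \in J >].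
have PT : P [set: 'I_m]%SET by apply/asboolP => x /pgen[c c0 xc]; exists c => //; split.
have [J /minsetP[/asboolP PJ Jmin] _] := minset_exists PT.
(* No element of [J] is a combination of the other ones. *)
have red j (c : 'I_m -> R) : j \in J -> (forall i, 0 <= c i) ->
    (forall i, c i != 0 -> i \in J :\ j) -> ~ lincomb (V a) (p j) c p.
  move=> jJ c0 cJ pj; suff : J \subset J :\ j by move=> /fintype.subsetP/(_ j jJ); rewrite !inE eqxx.
  rewrite (Jmin (J :\ j)) ?subD1set //; apply/asboolP => x /PJ[e e0 [xe eJ]].
  exists (fun i => (if i == j then 0 else e i) + e j * c i).
    by move=> i; rewrite addr_ge0 ?mulr_ge0 //; case: ifP.
  split=> [u Vu|i].
    under eq_bigr do rewrite mulrDl.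
    rewrite big_split /= (xe u Vu) (bigD1 j) //= [X in _ = X + _](bigD1 j) //= eqxx mul0r add0r.
    rewrite addrC; congr (_ + _); first by apply: eq_bigr => i /negPf ->.
    by under eq_bigr do rewrite -mulrA; rewrite -mulr_sumr -pj.
  apply: contraNT => iJ; have cN : c i = 0 by apply: contraNeq iJ => /cJ.
  rewrite cN mulr0 addr0; have [_|ij] := eqVneq i j; first by rewrite eqxx.
  by apply/eqP; apply: contraNeq iJ => /eJ; rewrite !inE ij.
have pn0 i : i \in J -> p i <> origin S.
  move=> iJ pi0; apply: (red i (fun=> 0)) => // [j|u Vu]; first by rewrite eqxx.
  by rewrite pi0 (origin_val Vu) big1 // => j _; rewrite mul0r.
exists m, p; split => // x /PJ[c c0 [xc cJ]]; exists c => //; split => // j /cJ jJ.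
split; first exact: pn0.
have H i : exists u, i \in J :\ j -> [/\ V a u, forall l, l \in J -> 0 <= u (p l),
    u (p j) = 0 & 0 < u (p i)].
  have [iJ|] := boolP (i \in J :\ j); last by exists (fun=> 0).
  apply: contrapT => /forallNP nu.
  have {}nu u : V a u -> (forall l, l \in J -> 0 <= u (p l)) -> u (p j) <= 0 -> u (p i) <= 0.
    move=> Vu u0 uj; rewrite leNgt; apply/negP => ui; apply: (nu u) => _; split => //.
    by apply/eqP; rewrite eq_le uj u0.
  have [u Vu up|e e0 pe] := @farkas_points_signed _ _ (V a) (linear_fun_findim a) (option 'I_m)
      (fun o => if o is Some l then (l \in J)%:R else -1)
      (fun o => if o is Some l then p l else p j) (-1) (p i).
    rewrite mulN1r oppr_ge0; apply: nu => // [l lJ|].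
      by have := up (Some l); rewrite lJ mul1r.
    by have := up None; rewrite mulN1r oppr_ge0.
  (* The terms with [p j] are collected on the left-hand side. *)
  pose e' l := if l == j then 0 else (l \in J)%:R * e (Some l).
  have e'0 l : 0 <= e' l by rewrite /e'; case: ifP => // _; rewrite mulr_ge0.
  have {}pe u : V a u -> (e None - e (Some j)) * u (p j) = u (p i) + \sum_l e' l * u (p l).
    move=> /pe; rewrite sum_option (bigD1 j) //= jJ [in X in _ -> X](bigD1 j) //= {1}/e' eqxx.
    under [in X in _ -> X]eq_bigr => l lj do rewrite /e' (negPf lj) -mulrA mulrCA.
    by lra.
  have [y ay yE] := cell_conic_closed e'0 ap.
  (* According to the sign of its coefficient, either [p i] and its opposite
     are in the cell or [p j] is a combination of the others. *)
  have [le|lt] := leP (e None) (e (Some j)).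
    have [z az zE] := @cell_scale _ _ a (e (Some j) - e None) (p j) ltac:(lra) (ap j).
    have [w aw wE] := @cell_conic_closed _ _ a bool (fun=> 1) (fun o => if o then y else z)
      (fun=> ler01) ltac:(by case).
    have : i \in J by move: iJ; rewrite !inE => /andP[].
    move=> /pn0; apply; apply: (cell_pointed (ap i) aw) => u Vu.
    by rewrite wE // big_bool /= yE // zE //; have := pe u Vu; lra.
  have t0 : 0 < e None - e (Some j) by lra.
  apply: (red j (fun l => (e None - e (Some j))^-1 * ((l == i)%:R + e' l))) => //.
  - by move=> l; rewrite mulr_ge0 ?addr_ge0 // invr_ge0 ltW.
  - move=> l; apply: contraNT => lJ; have -> : (l == i) = false.
      by apply: contraNF lJ => /eqP ->.
    rewrite add0r /e'; case: ifP => [_|lj]; first by rewrite mulr0.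
    by move: lJ; rewrite !inE lj /= => /negPf ->; rewrite mul0r mulr0.
  move=> u Vu; under eq_bigr do rewrite -mulrA mulrDl.
  rewrite -mulr_sumr big_split /= (bigD1 i) //= eqxx mul1r big1 ?addr0 => [|l /negPf ->]; last by rewrite mul0r.
  by rewrite -pe // mulKf // gt_eqF.
have {H}[U UP] := choice H.
pose M y := \sum_(i in J :\ j) 1 * U i y.
have VM : V a M by apply: linear_fun_sum; [exact: linear_fun_findim|move=> i /UP[]].
have Mp l : l \in J -> 0 <= M (p l).
  by move=> lJ; apply: sumr_ge0 => i /UP[_ + _ _]; rewrite mul1r; exact.
have M0 y : cone a y -> 0 <= M y.
  move=> /PJ[e e0 [ye eJ]]; rewrite (ye M VM); apply: sumr_ge0 => l _.
  have [->|/eJ /Mp lJ] := eqVneq (e l) 0; first by rewrite mul0r.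
  by rewrite mulr_ge0.
have Mj : M (p j) = 0.
  by rewrite /M big1 // => i /UP[_ _ ? _]; rewrite mul1r.
have MJ l : l \in J :\ j -> 0 < M (p l).
  move=> lJ; rewrite /M (bigD1 l) //= mul1r ltr_pwDl //; first by have [] := UP l lJ.
  apply: sumr_ge0 => i /andP[/UP[_ + _ _] _]; rewrite mul1r; apply.
  by move: lJ; rewrite !inE => /andP[].
have [|b [bE Vb]] := @cone_face _ S a (cone a `&` [set y | M y = 0]).
  by apply/cell_faceP => //; exists M.
exists b; first by split => //; exists M.
rewrite bE; apply/seteqP; split => y.
  move=> [ay /= My]; apply/(rayP _ (ap j)); split => //.
  have [e e0 [ye eJ]] := PJ y ay; exists (e j) => // u Vu.
  rewrite (ye u Vu) (bigD1 j) //= big1 ?addr0 // => i ij.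
  move: My; rewrite (ye M VM) => /eqP; rewrite psumr_eq0; last first.
    move=> l _; have [->|/eJ /Mp lJ] := eqVneq (e l) 0; first by rewrite mul0r.
    by rewrite mulr_ge0.
  move=> /allP /(_ i); rewrite mem_index_enum => /(_ isT) /=.
  rewrite mulf_eq0 => /orP[/eqP ->|/eqP Mi]; first by rewrite mul0r.
  have [->|/eJ iJ] := eqVneq (e i) 0; first by rewrite mul0r.
  by have := MJ i; rewrite !inE ij iJ Mi ltxx => /(_ isT).
move=> /(rayP _ (ap j))[ay [r r0 yr]]; split => //=.
by rewrite yr // Mj mulr0.
Qed.
End ExtremeRays.

(** * Integral points and rational cones *)

Section Integral.
Context {R : realType} {S : conicalComplex R} (L : integralStructure S).
Implicit Types (a b d : cell S) (x y z : S) (T F : set S).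
Local Notation V a := (linear_fun a).

Lemma lattice_fun k (f : 'I_k -> S -> R) a i : lattice_basis_of (V a) (lattice L a) f ->
  lattice L a (f i).
Proof.
move=> [_ ->]; exists (delta_mx 0 i) => //; apply/funext => x.
rewrite (bigD1 i) //= mxE !eqxx mul1r big1 ?addr0 // => j /negPf ji.
by rewrite mxE ji andbF mul0r.
Qed.

Lemma integral_basis a k (f : 'I_k -> S -> R) x :
  lattice_basis_of (V a) (lattice L a) f -> cone a x ->
  (forall i, f i x \is a Num.int) -> integral_point L a x.
Proof.
move=> [_ LE] ax fx; split => // u; rewrite LE => -[c _ <-].
by apply: rpred_sum => i _; rewrite rpredM // intr_int.
Qed.

Lemma integral_subcell d a x : subcell d a -> cone d x ->
  integral_point L d x <-> integral_point L a x.
Proof.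
move=> da dx; have LE := lattice_face L (subcell_face_of da).
split=> -[_ xi]; split; rewrite ?LE //.
- exact: (subcell_sub da).
- move=> u Lu; have := xi (u \_ (cone d)); rewrite LE patchT ?inE //; apply.
  by exists u.
- by move=> _ [u Lu <-]; rewrite patchT ?inE //; exact: xi.
Qed.

Lemma integral_any a b x : integral_point L b x -> cone a x -> integral_point L a x.
Proof.
move=> bx ax; have bx' : cone b x by case: bx.
apply/(integral_subcell (relint_cell_subcell ax) (relint_cell_cone x)).
exact/(integral_subcell (relint_cell_subcell bx') (relint_cell_cone x)).
Qed.

(** Denominators are cleared by scaling the generators, which turns rational
    cones into cones generated by integral points. *)
Lemma rational_hullP a T : rational_in L a T <-> exists m (p : 'I_m -> S),
  (forall i, integral_point L a (p i)) /\ T = hull a p.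
Proof.
split.
  move=> [aT [k [f [fb [m [v Tv]]]]]].
  have [p [ap pv TE]] := chart_conic_hullP fb.1 aT Tv.
  (* a common denominator of the coordinates *)
  pose N i : int := \prod_j denq (v i 0 j).
  have N0 i : 0 < (N i)%:~R :> R.
    by rewrite ltr0z; apply: prodr_gt0 => j _; exact: denq_gt0.
  have H i : exists q, cone a q /\ forall u, V a u -> u q = (N i)%:~R * u (p i).
    by have [q aq qE] := cell_scale (ltW (N0 i)) (ap i); exists q.
  have {H}[q qP] := choice H.
  exists m, q; split => [i|].
    apply: (integral_basis fb) => [|j]; first exact: (qP i).1.
    rewrite (qP i).2; last exact: (basis_fun j fb.1).
    have -> : f j (p i) = ratr (v i 0 j).
      by have := congr1 (fun M : 'rV_k => M 0 j) (pv i); rewrite !mxE.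
    rewrite /N (bigD1 j) //= intrM mulrAC.
    have -> : (denq (v i 0 j))%:~R * ratr (v i 0 j) = (numq (v i 0 j))%:~R :> R.
      by have := congr1 (@ratr R) (numqE (v i 0 j)); rewrite rmorphM /= !ratr_int mulrC => ->.
    by rewrite rpredM ?intr_int.
  rewrite TE; apply/seteqP; split; apply: hull_trans => i.
    split => //; exists (fun j => (j == i)%:R / (N i)%:~R).
      by move=> j; rewrite divr_ge0 // ltW.
    move=> u Vu; rewrite (bigD1 i) //= eqxx big1 ?addr0 => [|j /negPf ->]; last by rewrite !mul0r.
    by rewrite (qP i).2 // mul1r mulKf // gt_eqF.
  split; first exact: (qP i).1; exists (fun j => (j == i)%:R * (N i)%:~R).
    by move=> j; rewrite mulr_ge0 // ltW.
  move=> u Vu; rewrite (bigD1 i) //= eqxx big1 ?addr0 => [|j /negPf ->]; last by rewrite !mul0r.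
  by rewrite (qP i).2 // mul1r.
move=> [m [p [pi ->]]]; split; first exact: hull_sub.
have [k [f fb]] := latticeP L a; exists k, f; split => //.
exists m, (fun i => \row_j (Num.floor (f j (p i)))%:~R).
rewrite (chart_hull fb.1) => [|i]; last by case: (pi i).
congr conic_hull; apply/funext => i; apply/rowP => j; rewrite !mxE.
by rewrite ratr_int floorK //; apply: (pi i).2; exact: lattice_fun.
Qed.

Lemma rational_point x a T : rational_in L a T -> T x -> x <> origin S ->
  exists y, [/\ T y, y <> origin S & integral_point L a y].
Proof.
move=> /rational_hullP[m [p [pi ->]]] [ax [c c0 xc]] xo.
apply: contrapT => no; apply: xo; apply: (@cell_separated _ _ a) => //; first exact: origin_cone.
move=> u Vu; rewrite (xc u Vu) (origin_val Vu) big1 // => i _.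
have -> : p i = origin S.
  apply: contrapT => po; apply: no; exists (p i); split => //.
  by apply: hull_gen; case: (pi i).
by rewrite (origin_val Vu) mulr0.
Qed.

End Integral.

(** * Regular subdivisions *)

Section Regular.
Context {R : realType} {S : conicalComplex R} (L : integralStructure S).
Implicit Types (a b d : cell S) (x y z : S) (T F : set S) (K : set (cell S)).
Local Notation V a := (linear_fun a).

(** The points that will carry the heights.  Those in a cell have to span it, so
    that the upper hull of the heights is defined on all of the cell. *)
Record generating (N : nat) (v : 'I_N -> S) : Prop := Generating {
  generating_origin : forall i, v i <> origin S;
  generating_integral : forall i a, cone a (v i) -> integral_point L a (v i);
  generating_span : forall a x, cone a x -> exists2 c, (forall i, 0 <= c i) &
    lincomb (V a) x c v /\ forall i, c i != 0 -> cone a (v i)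
}.

Variables (N : nat) (v : 'I_N -> S) (h : S -> R).
Hypothesis h_slicing : slicing_function h.
Hypothesis vG : generating v.

Let v_origin := generating_origin vG.
Let v_integral := generating_integral vG.
Let v_span := generating_span vG.

Implicit Types (w : 'I_N -> R) (u : S -> R) (B : {set 'I_N}).

(** Subfamilies keep the index set ['I_N], the other points being replaced by the
    origin, which contributes nothing to a combination. *)
Definition masked B (i : 'I_N) : S := if i \in B then v i else origin S.

Lemma masked_cone a B : (forall i, i \in B -> cone a (v i)) -> forall i, cone a (masked B i).
Proof. by move=> aB i; rewrite /masked; case: ifP => [/aB|] // _; exact: origin_cone. Qed.

Lemma hull_masked a B x : (hull a (masked B)) x <-> cone a x /\
  exists2 c, (forall i, 0 <= c i) & lincomb (V a) x c v /\ forall i, c i != 0 -> i \in B.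
Proof.
split=> -[ax]; last first.
  move=> [c c0 [xc cB]]; split => //; exists c => // u Vu; rewrite (xc u Vu).
  apply: eq_bigr => i _; rewrite /masked; case: ifP => // iB.
  have ci : c i = 0 by apply: contraFeq iB => /cB.
  by rewrite ci !mul0r.
move=> [c c0 xc]; split => //; exists (fun i => if i \in B then c i else 0).
  by move=> i; case: ifP.
split=> [u Vu|i]; last by case: ifP => //; rewrite eqxx.
rewrite (xc u Vu); apply: eq_bigr => i _; rewrite /masked; case: ifP => // _.
by rewrite (origin_val Vu) mul0r mulr0.
Qed.

Lemma slicing_pos a : exists2 u, V a u & forall x, cone a x -> x <> origin S -> 0 < u x.
Proof.
have [_ h0 /(_ a)[u Vu hu] hz] := h_slicing; exists u => // x ax xo.
rewrite -hu // lt0r h0 andbT; apply/eqP => /hz; exact: xo.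
Qed.

Definition majorant a w u : Prop := V a u /\ forall i, cone a (v i) -> w i <= u (v i).

Definition tight a w u : {set 'I_N} :=
  [set i | `[< cone a (v i) /\ u (v i) = w i >]]%SET.

Lemma tightP a w u i : i \in tight a w u <-> cone a (v i) /\ u (v i) = w i.
Proof. by rewrite inE; split => /asboolP. Qed.

Definition contact_cone a w u : set S := hull a (masked (tight a w u)).

Lemma tight_cone a w u i : cone a (masked (tight a w u) i).
Proof. by apply: masked_cone => j /tightP[]. Qed.

Lemma contact_cone_gen a w u i : i \in tight a w u -> contact_cone a w u (v i).
Proof.
move=> iB; have -> : v i = masked (tight a w u) i by rewrite /masked iB.
exact/hull_gen/tight_cone.
Qed.

Lemma lincomb_le_majorant a w u x c : majorant a w u -> (forall i, 0 <= c i) ->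
  (forall i, c i != 0 -> cone a (v i)) -> lincomb (V a) x c v ->
  \sum_i c i * w i <= u x.
Proof.
move=> [Vu uw] c0 ca xc; rewrite xc //; apply: ler_sum => i _.
have [->|/ca/uw wi] := eqVneq (c i) 0; first by rewrite !mul0r.
by rewrite ler_wpM2l.
Qed.

(** Complementary slackness. *)
Lemma lincomb_eq_tight a w u x c i : majorant a w u -> (forall i, 0 <= c i) ->
  (forall i, c i != 0 -> cone a (v i)) -> lincomb (V a) x c v ->
  u x <= \sum_i c i * w i -> c i != 0 -> i \in tight a w u.
Proof.
move=> [Vu uw] c0 ca xc; rewrite xc // -subr_le0 -sumrB => le0 ci.
have t0 j : 0 <= c j * u (v j) - c j * w j.
  rewrite -mulrBr; have [->|/ca/uw wj] := eqVneq (c j) 0; first by rewrite !mul0r.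
  by rewrite mulr_ge0 // subr_ge0.
have /eqP : \sum_i (c i * u (v i) - c i * w i) = 0.
  by apply/eqP; rewrite eq_le le0 sumr_ge0.
rewrite psumr_eq0 // => /allP /(_ i); rewrite mem_index_enum => /(_ isT) /=.
rewrite -mulrBr mulf_eq0 (negPf ci) subr_eq0 => /eqP E.
by apply/tightP; split => //; exact: ca.
Qed.

Lemma contact_coneP a w u x : majorant a w u ->
  contact_cone a w u x <-> cone a x /\
  exists2 c, (forall i, 0 <= c i) & [/\ lincomb (V a) x c v,
    forall i, c i != 0 -> cone a (v i) & u x = \sum_i c i * w i].
Proof.
move=> uw; rewrite /contact_cone hull_masked; split=> -[ax [c c0]].
  move=> [xc cB]; split => //; exists c => //; split => // [i /cB/tightP[]//|].
  rewrite (xc u uw.1); apply: eq_bigr => i _.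
  have [->|/cB/tightP[_ ->]//] := eqVneq (c i) 0; first by rewrite !mul0r.
move=> [xc ca ux]; split => //; exists c => //; split => // i.
by apply: (lincomb_eq_tight uw c0 ca xc); rewrite ux.
Qed.

(** Linear programming duality.  Let [t] be the supremum of the heights
    [\sum_i c i * w i] over the ways to write [x] as a combination of generators;
    it is finite since a large multiple of the slicing function is a majorant.
    Farkas' lemma for the homogenized inequalities [s * w i <= u (v i)] and
    [u x <= s * t] in [(u, s)] produces a majorant [u] with [u x <= t].  If [x]
    were not spanned by the generators at which [u] is tight, a function
    separating it from them could be used to lower [u x] below [t]. *)
Lemma majorant_exists a w x : cone a x ->
  exists2 u, majorant a w u & contact_cone a w u x.
Proof.
move=> ax; have [hu Vh hpos] := slicing_pos a.
pose feas c := [/\ forall i, 0 <= c i, lincomb (V a) x c v & forall i, c i != 0 -> cone a (v i)].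
pose A := [set \sum_i c i * w i | c in [set c : 'I_N -> R | feas c]].
have Aub u : majorant a w u -> ubound A (u x).
  by move=> uw _ [c [c0 xc ca] <-]; exact: (lincomb_le_majorant uw).
(* a large multiple of the slicing function *)
have [u0 u0w] : exists u0, majorant a w u0.
  pose k i := `|w i| / hu (v i).
  exists (fun y => (\sum_(i | `[<cone a (v i)>]) k i) * hu y); split.
    by apply: linear_funZ => //; exact: linear_fun_findim.
  move=> i ai; have hi := hpos _ ai (@v_origin i).
  apply: (le_trans (ler_norm _)); rewrite -ler_pdivrMr //.
  rewrite (bigD1 i) /=; last exact/asboolP.
  rewrite lerDl; apply: sumr_ge0 => j /andP[/asboolP aj _].
  by rewrite divr_ge0 // ltW // hpos.
have Asup : has_sup A.
  split; last by exists (u0 x); exact: Aub.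
  by have [c c0 [xc ca]] := v_span ax; exists (\sum_i c i * w i), c.
pose t := sup A.
have At c : feas c -> \sum_i c i * w i <= t.
  by move=> fc; apply: ub_le_sup; [case: Asup|exists c].
have [u [Vu uw ux]] : exists u, [/\ V a u, forall i, cone a (v i) -> w i <= u (v i) & u x <= t].
  have [k [f fb]] := linear_fun_findim a.
  pose ev y (l : 'cV[R]_k) : R := (chart f y *m l) 0 0.
  have evD y r l l' : ev y (r *: l + l') = r * ev y l + ev y l'.
    by rewrite /ev mulmxDr -scalemxAr !mxE.
  pose G (o : option 'I_N) (l : 'cV[R]_k * R^o) : R :=
    if o is Some i then (`[< cone a (v i) >])%:R * (ev (v i) l.1 - l.2 * w i)
    else l.2 * t - ev x l.1.
  (* If no solution has [0 < s], Farkas' lemma expresses [- s] through the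
     constraints. *)
  have [[l s] [lG s0]] : exists l, (forall o, 0 <= G o l) /\ 0 < l.2.
    apply: contrapT => /forallNP no.
    have [||l lG|c c0 cE] := @farkas_fin R ('cV[R]_k * R^o)%type _ G (fun l => - l.2).
    - move=> [i|] r l l' /=; rewrite /G /= evD; last by rewrite /GRing.scale /=; ring.
      by rewrite /GRing.scale /=; ring.
    - by move=> r l l' /=; rewrite /GRing.scale /=; ring.
    - by rewrite oppr_ge0 leNgt; apply/negP => s0; apply: (no l).
    pose e i := c (Some i) * (`[< cone a (v i) >])%:R.
    have e0 i : 0 <= e i by rewrite mulr_ge0.
    have ea i : e i != 0 -> cone a (v i).
      by rewrite /e; case: asboolP => //; rewrite mulr0 eqxx.
    have E1 : \sum_i e i * w i = c None * t + 1.
      have := cE (0, 1); rewrite /= sum_option /= /ev mulmx0 mxE subr0 mul1r.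
      under eq_bigr do rewrite mulmx0 mxE sub0r mul1r mulrA mulrN -/(e _).
      by rewrite sumrN; lra.
    have E2 u : V a u -> c None * u x = \sum_i e i * u (v i).
      move=> /(chart_funP fb)[l ul]; have := cE (l, 0); rewrite /= sum_option /= /ev mul0r.
      under eq_bigr do rewrite mul0r subr0 mulrA -/(e _) -ul.
      by rewrite -ul; lra.
    (* If [c None = 0], the combination [E2] is zero, which forces [e = 0] as
       the slicing function is positive; else it beats the supremum [t]. *)
    have [cN|cN] := eqVneq (c None) 0.
      move: E1; rewrite cN mul0r add0r big1 => [/eqP|i _]; first by rewrite eq_sym oner_eq0.
      have [->|ei] := eqVneq (e i) 0; first by rewrite mul0r.
      have /esym/eqP := E2 hu Vh; rewrite cN mul0r psumr_eq0; last first.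
        move=> j _; have [->|/ea aj] := eqVneq (e j) 0; first by rewrite mul0r.
        by rewrite mulr_ge0 // ltW // hpos.
      move=> /allP /(_ i); rewrite mem_index_enum => /(_ isT) /=.
      by rewrite mulf_eq0 (negPf ei) gt_eqF // hpos //; exact: ea.
    have cN0 : 0 < c None by rewrite lt0r cN c0.
    have : \sum_i (e i / c None) * w i <= t.
      apply: At; split => [i|u Vu|i].
      - by rewrite divr_ge0.
      - under eq_bigr do rewrite mulrAC.
        by rewrite -mulr_suml -E2 // mulrAC mulfV // mul1r.
      - by rewrite mulf_eq0 negb_or => /andP[/ea].
    under eq_bigr do rewrite mulrAC.
    by rewrite -mulr_suml E1 ler_pdivrMr // mulrC; lra.
  have uE y : (chart f y *m (s^-1 *: l)) 0 0 = s^-1 * ev y l.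
    by rewrite -scalemxAr mxE.
  exists (fun y => (chart f y *m (s^-1 *: l)) 0 0); split.
  - exact: chart_fun.
  - move=> i ai; have := lG (Some i); rewrite /G /= asboolT // mul1r uE => le0.
    by rewrite mulrC ler_pdivlMr // mulrC; lra.
  - have := lG None; rewrite /G /= uE => le0.
    by rewrite mulrC ler_pdivrMr // mulrC; lra.
exists u; first by split.
suff [c c0 xc] : exists2 c, (forall i, 0 <= c i) & lincomb (V a) x c (masked (tight a w u)).
  by split => //; exists c.
apply: farkas_points; first exact: linear_fun_findim.
move=> m Vm mt; rewrite leNgt; apply/negP => mx.
have [e e0 ee] := @small_step R _ (fun i => `[< cone a (v i) /\ u (v i) <> w i >])
  (fun i => u (v i) - w i) (fun i => m (v i))
  (fun i => ltac:(by move=> /asboolP[ai /eqP ne]; rewrite subr_gt0 lt_neqAle eq_sym ne uw)).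
have u'w : majorant a w (fun y => e * m y + u y).
  split; first by apply: linear_fun_lin => //; exact: linear_fun_findim.
  move=> i ai; have [uwi|uwi] := pselect (u (v i) = w i).
    have := mt i; rewrite /masked (_ : i \in _); last by apply/tightP.
    by move=> mi; rewrite -uwi lerDr mulr_ge0 // ltW.
  by have := ee i (asboolT (conj ai uwi)); lra.
have : t <= e * m x + u x by apply: ge_sup; [case: Asup|exact: (Aub _ u'w)].
have : e * m x < 0 by rewrite pmulr_rlt0.
lra.
Qed.

(** The upper hull is defined by its value on certificates, in any cell;
    [contact_cone_le] shows that all of them agree. *)
Definition upper_hull w x : R :=
  xget 0 [set r | exists a u,
    [/\ majorant a w u, contact_cone a w u x & r = u x]].

(** The minimum is attained exactly on the contact cone, and this can be tested
    against majorants on another cell, because [x] is a combination of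
    generators of a common face of both. *)
Lemma contact_cone_le a b w u u' x : majorant a w u ->
  contact_cone a w u x -> majorant b w u' -> cone b x ->
  u x <= u' x /\ (u' x <= u x -> contact_cone b w u' x).
Proof.
move=> uw /(contact_coneP _ uw)[ax [c c0 [xc ca ux]]] u'w bx.
have cd i : c i != 0 -> cone (relint_cell x) (v i).
  exact: (subcell_supp (relint_cell_subcell ax) (relint_cell_cone x) c0 ca xc).
have cb i : c i != 0 -> cone b (v i).
  by move=> /cd; exact: (subcell_sub (relint_cell_subcell bx)).
have xcb : lincomb (V b) x c v.
  apply/(subcell_lincomb_supp (relint_cell_subcell bx) (relint_cell_cone x) cd).
  exact/(subcell_lincomb_supp (relint_cell_subcell ax) (relint_cell_cone x) cd).
have le := lincomb_le_majorant u'w c0 cb xcb.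
rewrite ux; split => // ge; apply/(contact_coneP _ u'w); split => //; exists c => //; split => //.
by apply/eqP; rewrite eq_le le ge.
Qed.

Lemma upper_hullE a w u x :
  majorant a w u -> contact_cone a w u x -> upper_hull w x = u x.
Proof.
move=> uw xu; rewrite /upper_hull; case: xgetP => [r -> [b [u' [u'w xu' ->]]]|/(_ (u x))]; last first.
  by case; exists a, u.
apply/eqP; rewrite eq_le; have := hull_sub xu; have := hull_sub xu'.
by move=> bx ax; rewrite (contact_cone_le uw xu u'w bx).1 (contact_cone_le u'w xu' uw ax).1.
Qed.

Lemma upper_hull_le a w u x : majorant a w u -> cone a x -> upper_hull w x <= u x.
Proof.
move=> uw ax; have [u' u'w xu'] := majorant_exists w ax.
by rewrite (upper_hullE u'w xu'); exact: (contact_cone_le u'w xu' uw ax).1.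
Qed.

Lemma contact_coneE a w u x : majorant a w u ->
  contact_cone a w u x <-> cone a x /\ upper_hull w x = u x.
Proof.
move=> uw; split=> [xu|[ax xu]]; first by split; [exact: (hull_sub xu)|exact: (upper_hullE uw xu)].
have [u' u'w xu'] := majorant_exists w ax.
by apply: (contact_cone_le u'w xu' uw ax).2; rewrite -xu -(upper_hullE u'w xu').
Qed.

Lemma contact_cone_restrict d a w u : subcell d a -> majorant a w u ->
  exists2 u', majorant d w u' & contact_cone d w u' = contact_cone a w u `&` cone d.
Proof.
move=> da [Vu uw]; have [u' Vu' uu'] := subcell_fun da Vu.
have u'w : majorant d w u'.
  by split => // i di; rewrite uu' //; apply: uw; exact: (subcell_sub da).
exists u' => //; apply/seteqP; split => x.
  move=> /(contact_coneE _ u'w)[dx xu']; split => //; apply/(contact_coneE _ (conj Vu uw)).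
  by split; [exact: (subcell_sub da)|rewrite xu' uu'].
move=> [/(contact_coneE _ (conj Vu uw))[ax xu] dx]; apply/(contact_coneE _ u'w); split => //.
by rewrite xu uu'.
Qed.

(** A majorant on a face extends to the cell, and adding a large multiple of a
    supporting function of the face makes it strict off the face. *)
Lemma contact_cone_extend d a w u : subcell d a -> majorant d w u ->
  exists2 u', majorant a w u' & contact_cone a w u' = contact_cone d w u.
Proof.
move=> da [Vu uw]; have [u' Vu' uu'] := subcell_ext da Vu.
have [[m [Vm m0 dE]] _] := da.
have [e e0 ee] := @small_step R _ (fun i => `[< cone a (v i) /\ m (v i) <> 0 >])
  (fun i => m (v i)) (fun i => u' (v i) - w i)
  (fun i => ltac:(by move=> /asboolP[ai /eqP ne]; rewrite lt0r ne m0)).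
pose u2 y := e^-1 * m y + u' y.
have u2d y : cone d y -> u2 y = u y.
  by move=> dy; rewrite /u2 uu' //; move: dy; rewrite dE => -[_ /= ->]; rewrite mulr0 add0r.
have u2n i : cone a (v i) -> ~ cone d (v i) -> w i < u2 (v i).
  move=> ai di; have mi : m (v i) <> 0 by move=> mi; apply: di; rewrite dE.
  have := ee i (asboolT (conj ai mi)); rewrite /u2.
  have : e * (e^-1 * m (v i) + u' (v i) - w i) = m (v i) + e * (u' (v i) - w i).
    by field; rewrite gt_eqF.
  by move=> <-; rewrite pmulr_rgt0 //; lra.
have u2w : majorant a w u2.
  split; first by apply: linear_fun_lin => //; exact: linear_fun_findim.
  move=> i ai; have [di|di] := pselect (cone d (v i)); first by rewrite u2d //; exact: uw.
  by apply/ltW/u2n.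
exists u2 => //; rewrite /contact_cone.
have -> : tight a w u2 = tight d w u.
  apply/setP => i; apply/idP/idP => /tightP[ai ui]; apply/tightP.
    have [di|di] := pselect (cone d (v i)); first by rewrite -u2d.
    by have := u2n i ai di; rewrite ui ltxx.
  by split; [exact: (subcell_sub da)|rewrite u2d].
by rewrite (hull_subcell da) // => i; exact: tight_cone.
Qed.

Definition regular_subdivision K w : set (set S) :=
  [set T | exists2 a, K a & exists2 u, majorant a w u & T = contact_cone a w u].

(** Membership in the subdivision can be tested in any cell that contains the
    cone. *)
Lemma regular_local K a w T : regular_subdivision K w T -> T `<=` cone a ->
  exists2 u, majorant a w u & T = contact_cone a w u.
Proof.
move=> [b _ [u uw ->]] aT.
have [d [da db dt]] := hull_local (@tight_cone b w u) aT.
have [u1 u1w E1] := contact_cone_restrict db uw.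
have [u2 u2w E2] := contact_cone_extend da u1w.
exists u2 => //; rewrite E2 E1; apply/seteqP; split => [x xu|x []] //; split => //.
by move: xu; rewrite /contact_cone -(hull_subcell db dt) => /hull_sub.
Qed.

(** Adding a small multiple of the supporting function [m] of the face to [u]
    keeps [u] a majorant, and the tight generators that survive are those on
    which [m] vanishes. *)
Lemma contact_cone_face a w u F : majorant a w u -> face_in (V a) (contact_cone a w u) F ->
  exists2 u', majorant a w u' & F = contact_cone a w u'.
Proof.
move=> uw /(cell_faceP _ (@hull_sub _ _ _ _ _)).
move=> [m Vm [m0 ->]]; have [Vu uw'] := uw.
have [e e0 ee] := @small_step R _ (fun i => `[< cone a (v i) /\ u (v i) <> w i >])
  (fun i => u (v i) - w i) (fun i => m (v i))
  (fun i => ltac:(by move=> /asboolP[ai /eqP ne]; rewrite subr_gt0 lt_neqAle eq_sym ne uw')).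
pose u2 y := e * m y + u y.
have u2n i : cone a (v i) -> u (v i) <> w i -> w i < u2 (v i).
  by move=> ai ui; have := ee i (asboolT (conj ai ui)); rewrite /u2; lra.
have u2w : majorant a w u2.
  split; first by apply: linear_fun_lin => //; exact: linear_fun_findim.
  move=> i ai; have [ui|ui] := pselect (u (v i) = w i); last by apply/ltW/u2n.
  rewrite /u2 ui lerDr mulr_ge0 ?(ltW e0) //; apply: m0.
  by apply: contact_cone_gen; apply/tightP.
exists u2 => //; apply/seteqP; split => x.
  move=> [/(contact_coneE _ uw)[ax xu] /= mx]; apply/(contact_coneE _ u2w); split => //.
  by rewrite xu /u2 mx mulr0 add0r.
rewrite {1}/contact_cone hull_masked => -[ax [c c0 [xc ct]]].
have ctu i : c i != 0 -> u (v i) = w i /\ m (v i) = 0.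
  move=> /ct/tightP[ai u2i].
  have [ui|ui] := pselect (u (v i) = w i); last first.
    by have := u2n i ai ui; rewrite u2i ltxx.
  split => //; move: u2i; rewrite /u2 ui => /eqP; rewrite -subr_eq0 addrK mulf_eq0 gt_eqF //=.
  by move=> /eqP.
split.
  rewrite /contact_cone hull_masked; split => //; exists c => //; split => // i ci.
  by apply/tightP; have [ui _] := ctu i ci; split => //; have /tightP[] := ct i ci.
rewrite /= (xc m Vm) big1 // => i _.
by have [->|/ctu[_ ->]] := eqVneq (c i) 0; rewrite ?mul0r ?mulr0.
Qed.

(** Two contact cones in the same cell, of [u] and [u'], meet in the face on
    which the function [u' - u], nonnegative on the first one, vanishes. *)
Lemma regular_subdivisionP K w : subdivision L K (regular_subdivision K w).
Proof.
split.
- apply: (@sub_finite_set _ _ [set hull p.1 (masked p.2) | p in [set: (cell S * {set 'I_N})%type]]).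
    by move=> _ [a Ka [u uw ->]]; exists (a, tight a w u).
  exact/finite_image/finite_finset.
- move=> _ [a Ka [u uw ->]]; exists a => //; apply/rational_hullP.
  exists N, (masked (tight a w u)); split => // i; rewrite /masked; case: ifP => [/tightP[ai _]|_].
    exact: v_integral.
  split; first exact: origin_cone.
  move=> l La; rewrite (@origin_val _ _ a) ?rpred0 //.
  have [k [f [fb LE]]] := latticeP L a; move: La; rewrite LE fb.2 => -[c _ <-].
  by exists (map_mx intr c) => //; apply/funext => y; apply: eq_bigr => j _; rewrite mxE.
- move=> a T F Ka DT aT Tf; have [u uw E] := regular_local DT aT; rewrite E in Tf.
  by have [u' u'w ->] := contact_cone_face uw Tf; exists a => //; exists u'.
- move=> a T1 T2 Ka D1 D2 a1 a2.
  have [u1 u1w E1] := regular_local D1 a1; have [u2 u2w E2] := regular_local D2 a2.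
  have key u u' : majorant a w u -> majorant a w u' ->
    face_in (V a) (contact_cone a w u)
      (contact_cone a w u `&` contact_cone a w u').
    move=> uw u'w; apply/(cell_faceP _ (@hull_sub _ _ _ _ _)).
    exists (fun x => u' x - u x); first by apply: linear_funB; [exact: linear_fun_findim|exact: u'w.1|exact: uw.1].
    split=> [x /(contact_coneE _ uw)[ax xu]|]; first by rewrite subr_ge0 -xu; exact: (upper_hull_le u'w ax).
    apply/seteqP; split => x [xu].
      move=> xu'; split => //=; rewrite -(upper_hullE uw xu) -(upper_hullE u'w xu'); lra.
    move=> /= uu; split => //; apply/(contact_coneE _ u'w); split; first exact: hull_sub xu.
    by rewrite (upper_hullE uw xu); lra.
  by rewrite E1 E2; split; [exact: key|rewrite setIC; exact: key].
- apply/seteqP; split => x.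
    by move=> [_ [a Ka [u uw ->]] xu]; exists a => //; exact: hull_sub xu.
  move=> [a Ka ax]; have [u uw xu] := majorant_exists w ax.
  by exists (contact_cone a w u) => //; exists a => //; exists u.
Qed.

Lemma regular_linear K w : linear_on_cones K (regular_subdivision K w) (upper_hull w).
Proof.
move=> a T Ka DT aT; have [u uw E] := regular_local DT aT; exists u; first exact: uw.1.
by move=> x; rewrite E; exact: upper_hullE.
Qed.

(** The cone of [x], the sum of the generators of [T], contains [T]: a majorant
    that touches the upper hull at [x] exceeds it by a nonnegative linear
    function on [T], which vanishes at [x] and hence at all the generators. *)
Lemma regular_coarsest K w a T : K a -> rational_in L a T -> linear_on a T (upper_hull w) ->
  exists2 T', regular_subdivision K w T' & T `<=` T'.
Proof.
move=> Ka /rational_hullP[m [p [pi ->]]] [u1 Vu1 ru1].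
have ap i : cone a (p i) by case: (pi i).
have [x ax xc] := cell_conic_closed (fun i => @ler01 R) ap.
have [u uw xu] := majorant_exists w ax.
exists (contact_cone a w u); first by exists a => //; exists u.
apply: hull_trans => i; apply/(contact_coneE _ uw); split => //.
have hx : hull a p x by split => //; exists (fun=> 1).
have ge0 j : 0 <= u (p j) - u1 (p j).
  by rewrite -ru1; [rewrite subr_ge0; exact: (upper_hull_le uw (ap j))|exact: hull_gen].
have /eqP : \sum_j (u (p j) - u1 (p j)) = 0.
  rewrite sumrB; have := ru1 x hx; rewrite (upper_hullE uw xu).
  rewrite (xc u uw.1) (xc u1 Vu1).
  by under eq_bigr do rewrite mul1r; under [X in _ = X -> _]eq_bigr do rewrite mul1r; lra.
rewrite psumr_eq0 // => /allP /(_ i); rewrite mem_index_enum => /(_ isT) /=.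
by rewrite subr_eq0 => /eqP ->; rewrite ru1 //; exact: hull_gen.
Qed.

End Regular.

(** * Comparison of subdivisions *)

Section SubdivisionUnique.
Context {R : realType} {S : conicalComplex R} (L : integralStructure S).
Implicit Types (a b d : cell S) (x y z : S) (T F : set S) (K : set (cell S)).
Local Notation V a := (linear_fun a).

Lemma face_sub a T F T' : face_in (V a) T F -> T `<=` cone a ->
  F `<=` T' -> T' `<=` T -> face_in (V a) T' F.
Proof.
move=> + aT FT' T'T; move=> /(cell_faceP _ aT)[m Vm [m0 FE]].
apply/(cell_faceP _ (subset_trans T'T aT)); exists m => //.
split => [x /T'T/m0 //|].
apply/seteqP; split => [x Fx|x [T'x mx]]; last by rewrite FE; split => //; exact: T'T.
by split; [exact: FT'|move: Fx; rewrite FE => -[]].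
Qed.

(** If [T] is contained in [T1] and [T1] in [T2], with [T] and [T2] in [D], then
    [T] is a face of [T2], hence of [T1]. *)
Lemma subdivision_mutual K (D D' : set (set S)) : subdivision L K D -> subdivision L K D' ->
  (forall T, D T -> exists2 T', D' T' & T `<=` T') ->
  (forall T, D' T -> exists2 T', D T' & T `<=` T') -> D `<=` D'.
Proof.
move=> sD sD' DD' D'D T DT.
have [T1 D1 T01] := DD' T DT; have [T2 D2 T12] := D'D T1 D1.
have [a Ka [a2 _]] := subdivision_cone sD D2.
have a1 : T1 `<=` cone a by exact: (subset_trans T12).
have a0 : T `<=` cone a by exact: (subset_trans T01).
apply: (subdivision_face sD' Ka D1 a1).
have [_] := subdivision_meet sD Ka DT D2 a0 a2.
have -> : T `&` T2 = T by apply/setIidPl; exact: (subset_trans T01).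
by move=> /face_sub; apply.
Qed.

(** A cone [T] of the larger subdivision meets the smaller one in the cone [T1]
    that contains the sum of its generators.  A face of [T] containing that sum
    is all of [T], so [T] is contained in [T1] and a face of it. *)
Lemma subdivision_incl K (D D' : set (set S)) : subdivision L K D -> subdivision L K D' ->
  D `<=` D' -> D = D'.
Proof.
move=> sD sD' DD'; apply/seteqP; split => // T DT'.
have [a Ka rT] := subdivision_cone sD' DT'.
have [m [p [pi TE]]] := (rational_hullP L a T).1 rT.
have ap i : cone a (p i) by case: (pi i).
have [x ax xc] := cell_conic_closed (fun i => @ler01 R) ap.
have Tx : T x by rewrite TE; split => //; exists (fun=> 1).
have : support K x by exists a.
rewrite -(subdivision_support sD) => -[T1 D1 T1x].
have [b Kb [b1 _]] := subdivision_cone sD D1.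
have dp i : cone (relint_cell x) (p i).
  by apply: (subcell_supp (relint_cell_subcell ax) (relint_cell_cone x) _ _ xc); rewrite ?oner_neq0 // => *; exact: ler01.
have bT : T `<=` cone b.
  rewrite TE -(hull_subcell (relint_cell_subcell ax) dp) => y /hull_sub.
  exact: (subcell_sub (relint_cell_subcell (b1 _ T1x))).
have bp i : cone b (p i) by apply: (subcell_sub (relint_cell_subcell (b1 _ T1x))).
have TbE : T = hull b p.
  by rewrite TE -(hull_subcell (relint_cell_subcell ax) dp) (hull_subcell (relint_cell_subcell (b1 _ T1x)) dp).
have [fT f1] := subdivision_meet sD' Kb DT' (DD' _ D1) bT b1.
apply: (subdivision_face sD Kb D1 b1).
suff -> : T = T `&` T1 by [].
apply/seteqP; split => [y Ty|y []//]; split => //.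
move: fT => /(cell_faceP _ bT)[mm Vm [m0 mE]].
have mp i : mm (p i) = 0.
  have : (T `&` T1) x by [].
  rewrite mE => -[_ /= /eqP].
  have xcb : lincomb (V b) x (fun=> 1) p.
    have H e := @subcell_lincomb _ _ (relint_cell x) e 'I_m x (fun=> 1) p.
    apply/(H _ (relint_cell_subcell (b1 _ T1x)) (relint_cell_cone x) dp).
    exact/(H _ (relint_cell_subcell ax) (relint_cell_cone x) dp).
  have mp0 j : 0 <= mm (p j) by apply: m0; rewrite TbE; exact: hull_gen.
  rewrite (xcb mm Vm) psumr_eq0 => [|j _]; last by rewrite mul1r.
  by move=> /allP /(_ i); rewrite mem_index_enum mul1r => /(_ isT) /eqP.
suff : (T `&` T1) y by case.
rewrite mE; split => //=; move: Ty; rewrite TbE => -[_ [c c0 yc]].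
by rewrite (yc mm Vm) big1 // => i _; rewrite mp mulr0.
Qed.

End SubdivisionUnique.

(** * The upper hull as a lifting function *)

Lemma closed_within_preimage (X Y : topologicalType) (C : set X) (A : set Y)
    (u : X -> Y) :
  closed C -> {within C, continuous u} -> closed A -> closed (C `&` u @^-1` A).
Proof.
move=> cC /continuous_closedP cu cA; have /closed_subspaceP[W cW WE] := cu A cA.
by rewrite setIC -WE; exact: closedI.
Qed.

Section Lifting.
Context {R : realType} {S : conicalComplex R} (L : integralStructure S).
Implicit Types (a b d : cell S) (x y z : S) (T F : set S) (K : set (cell S)).
Local Notation V a := (linear_fun a).
Variables (N : nat) (v : 'I_N -> S) (h : S -> R).
Hypothesis h_slicing : slicing_function h.
Hypothesis vG : generating L v.
Implicit Types (w : 'I_N -> R) (u : S -> R) (B : {set 'I_N}).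

(** By Farkas' lemma, a hull is an intersection of closed half-spaces. *)
Lemma hull_closed a (I : finType) (p : I -> S) : (forall i, cone a (p i)) -> closed (hull a p).
Proof.
move=> ap; pose U := [set u | V a u /\ forall i, 0 <= u (p i)].
have -> : hull a p = \bigcap_(u in U) (cone a `&` u @^-1` [set r | 0 <= r]).
  apply/seteqP; split => x.
    move=> [ax [c c0 xc]] u [Vu up]; split => //=.
    by rewrite (xc u Vu); apply: sumr_ge0 => i _; rewrite mulr_ge0.
  move=> xU; have [|ax _] := xU (fun=> 0); first by split => //; apply: linear_fun0; exact: linear_fun_findim.
  split => //; apply: farkas_points; first exact: linear_fun_findim.
  by move=> u Vu up; have [|] := xU u.
apply: closed_bigI => u [Vu _]; apply: closed_within_preimage.
- exact: cone_closed.
- exact: linear_fun_continuous.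
- exact: closed_ge.
Qed.

Lemma upper_hull_continuous w : continuous (upper_hull v w).
Proof.
apply/continuous_closedP => A cA.
have sub := regular_subdivisionP h_slicing vG setT w.
have -> : upper_hull v w @^-1` A = \bigcup_(T in regular_subdivision v setT w) (T `&` upper_hull v w @^-1` A).
  rewrite -setI_bigcupl (subdivision_support sub) (_ : support setT = setT) ?setTI //.
  by apply/seteqP; split => // x _; exists (relint_cell x) => //; exact: relint_cell_cone.
apply: closed_bigcup; first exact: subdivision_finite sub.
move=> T [a _ [u uw ->]].
have -> : contact_cone v a w u `&` upper_hull v w @^-1` A = contact_cone v a w u `&` (cone a `&` u @^-1` A).
  apply/seteqP; split => x [xu] /=.
    by rewrite (upper_hullE uw xu) => Au; split => //; split => //; exact: hull_sub xu.
  by move=> [_ Au]; split => //=; rewrite (upper_hullE uw xu).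
apply: closedI; first by apply: hull_closed => i; exact: tight_cone.
apply: closed_within_preimage => //; first exact: cone_closed.
exact: linear_fun_continuous uw.1.
Qed.

Definition independent a B : Prop :=
  forall c : 'I_N -> R, (forall i, c i != 0 -> i \in B) ->
  (forall u, V a u -> \sum_i c i * u (v i) = 0) -> forall i, c i = 0.

Lemma contact_cone_simplicial a w u :
  independent a (tight v a w u) -> simplicial (contact_cone v a w u).
Proof.
set B := tight v a w u => iB; exists a; split; first exact: hull_sub.
have [k [f fb]] := linear_fun_findim a; exists k, f; split => //.
pose ev : 'I_#|B| -> 'I_N := @enum_val _ (mem B).
have evB j : ev j \in B by exact: (@fintype.enum_valP _ (mem B) j).
pose p j := v (ev j).
have ap j : cone a (p j) by have /tightP[] := evB j.
exists #|B|, (fun j => chart f (p j)); split; last first.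
  rewrite -(chart_hull fb) //; congr image; rewrite /contact_cone -/B; apply/seteqP; split; apply: hull_trans => i.
    rewrite /masked -/B; case: ifP => [Bi|_]; last exact: hull_origin.
    have -> : v i = p (enum_rank_in Bi i) by rewrite /p /ev fintype.enum_rankK_in.
    exact: hull_gen.
  exact: (contact_cone_gen (evB i)).
rewrite -kermx_eq0; apply/rowV0P => c /sub_kermxP cA.
pose e i := \sum_j (ev j == i)%:R * c 0 j.
have e0 : forall i, e i = 0.
  apply: iB => [i|u' Vu'].
    apply: contraNT => iB; rewrite /e big1 // => j _.
    by case: eqP => [ji|]; [move: iB; rewrite -ji evB|rewrite mul0r].
  have [l ul] := chart_funP fb Vu'.
  under eq_bigr do rewrite /e mulr_suml.
  rewrite exchange_big /=; transitivity (\sum_j c 0 j * u' (p j)).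
    apply: eq_bigr => j _; rewrite (bigD1 (ev j)) //= eqxx mul1r big1 ?addr0 // => i.
    by rewrite eq_sym => /negPf ->; rewrite !mul0r.
  have cA0 : \sum_j c 0 j *: chart f (p j) = 0.
    by rewrite -[RHS]cA mulmx_sum_row; apply: eq_bigr => j _; rewrite rowK.
  have : ((\sum_j c 0 j *: chart f (p j)) *m l) 0 0 = 0 by rewrite cA0 mul0mx mxE.
  rewrite mulmx_suml summxE => sum0; rewrite -[RHS]sum0; apply: eq_bigr => j _.
  by rewrite -scalemxAl mxE -ul.
apply/rowP => j; rewrite mxE -(e0 (ev j)) /e (bigD1 j) //= eqxx mul1r big1 ?addr0 // => i ij.
by rewrite (inj_eq (@fintype.enum_val_inj _ (mem B))) (negPf ij) mul0r.
Qed.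

(** The coefficients of [x] on an independent set of integral points solve a
    linear system with rational coefficients. *)
Lemma upper_hull_rational a w x : (forall i, exists q : rat, w i = ratr q) ->
  (forall u, majorant v a w u -> independent a (tight v a w u)) ->
  integral_point L a x -> exists q : rat, upper_hull v w x = ratr q.
Proof.
move=> wq ind xi; have ax : cone a x by case: xi.
have [u uw xu] := majorant_exists h_slicing vG w ax.
rewrite (upper_hullE uw xu).
move: (xu); rewrite /contact_cone hull_masked; set B := tight v a w u => -[_ [c c0 [xc cB]]].
have [k [f fb]] := latticeP L a.
have fl j y : integral_point L a y -> f j y = ratr (Num.floor (f j y))%:~R.
  by move=> [_ yi]; rewrite ratr_int floorK //; apply: yi; exact: lattice_fun fb.
have Bi i : i \in B -> integral_point L a (v i).
  by move=> /tightP[ai _]; exact: (generating_integral vG).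
pose A : 'M[rat]_(N, k) := \matrix_(i, j) if i \in B then (Num.floor (f j (v i)))%:~R else 0.
pose X : 'rV[rat]_k := \row_j (Num.floor (f j x))%:~R.
have AE i : i \in B -> chart f (v i) = row i (map_mx ratr A).
  by move=> iB; apply/rowP => j; rewrite !mxE iB; exact/fl/Bi.
have XE : chart f x = map_mx ratr X by apply/rowP => j; rewrite !mxE; exact: fl.
have : (X <= A)%MS.
  rewrite -(map_submx (@ratr R)) -XE ((lincomb_chart _ _ _ fb.1).1 xc).
  apply: summx_sub => i _; have [->|/cB iB] := eqVneq (c i) 0; first by rewrite scale0r sub0mx.
  by rewrite scalemx_sub // AE // row_sub.
move=> /submxP[D XD]; pose e i : R := if i \in B then ratr (D 0 i) else 0.
have xe : lincomb (V a) x e v.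
  apply/(lincomb_chart _ _ _ fb.1); rewrite XE XD map_mxM mulmx_sum_row.
  apply: eq_bigr => i _; rewrite /e; case: ifP => iB; first by rewrite AE // mxE.
  rewrite scale0r; apply/rowP => j; by rewrite !mxE iB rmorph0 mulr0.
have ce i : c i = e i.
  apply/eqP; rewrite -subr_eq0; apply/eqP.
  apply: (ind u uw (fun i => c i - e i)) => [j|u' Vu'].
    apply: contraNT => jB; rewrite /e (negPf jB) subr0.
    by apply: contraNT jB => /cB.
  by under eq_bigr do rewrite mulrBl; rewrite sumrB -xc // -xe // subrr.
have {wq}[q qw] := choice wq.
exists (\sum_i (if i \in B then D 0 i * q i else 0)).
rewrite (xe u uw.1) rmorph_sum /=; apply: eq_bigr => i _; rewrite /e; case: ifP => iB.
  by rewrite rmorphM /= -qw; have /tightP[_ ->] := iB.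
by rewrite mul0r rmorph0.
Qed.

Lemma upper_hull_lifting w : (forall i, exists q : rat, w i = ratr q) ->
  (forall a u, majorant v a w u -> independent a (tight v a w u)) ->
  lifting_function L setT (upper_hull v w).
Proof.
move=> wq ind; split.
- exact/continuous_subspaceT/upper_hull_continuous.
- move=> a l x z _ l0 [ax _ az zE].
  have [u uw xu] := majorant_exists h_slicing vG w ax.
  have zu : contact_cone v a w u z.
    have : hull a (fun _ : 'I_1 => x) z.
      split => //; exists (fun=> l) => // u' Vu'; rewrite big_ord1 zE //.
      by rewrite mul0r addr0.
    exact: hull_trans.
  by rewrite !(upper_hullE uw) // zE ?mul0r ?addr0 //; exact: uw.1.
- move=> a _; pose P (B : {set 'I_N}) := `[< exists2 u, majorant v a w u & B = tight v a w u >].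
  pose J := [set B | P B]%SET.
  pose ev : 'I_#|J| -> {set 'I_N} := @enum_val _ (mem J).
  have JP j : exists2 u, majorant v a w u & ev j = tight v a w u.
    by have := @fintype.enum_valP _ (mem J) j; rewrite inE => /asboolP.
  exists #|J|, (fun j => hull a (masked v (ev j))); split.
  + apply/seteqP; split => x; last by move=> [j _ /hull_sub].
    move=> ax; have [u uw xu] := majorant_exists h_slicing vG w ax.
    have uJ : tight v a w u \in J by rewrite inE; apply/asboolP; exists u.
    by exists (enum_rank_in uJ (tight v a w u)) => //; rewrite /ev fintype.enum_rankK_in.
  + move=> j; split; first exact: hull_sub.
    have [u uw ->] := JP j; have [k [f fb]] := linear_fun_findim a; exists k, f; split => //.
    exists N, (fun i => chart f (masked v (tight v a w u) i)); apply: chart_hull => //.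
    exact: tight_cone.
  + move=> j; have [u uw ->] := JP j; exists u; first exact: uw.1.
    by move=> x xu; exact: (upper_hullE uw).
- move=> a l m x y z _ l0 m0 [ax ay az zE].
  have [u uw zu] := majorant_exists h_slicing vG w az.
  rewrite (upper_hullE uw zu) zE ?lerD ?ler_wpM2l //; try exact: uw.1.
  + exact: (upper_hull_le h_slicing vG uw).
  + exact: (upper_hull_le h_slicing vG uw).
- by move=> a x _ xi; apply: upper_hull_rational xi => // u; exact: ind.
Qed.

End Lifting.

(** * The rays of a triangulation *)

Lemma finite_set_enum (T : choiceType) (A : set T) : finite_set A ->
  exists N (e : 'I_N -> T), injective e /\ range e = A.
Proof.
move=> /finite_seqP[s ->].
have := undup_uniq s; have := mem_undup s; move: (undup s) => r rs ru.
exists (size r), (fun i => tnth (in_tuple r) i); split=> [i j|].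
  case: r rs ru i j => [|t r] _ ru i j; first by case: i.
  by rewrite !(tnth_nth t) => /eqP; rewrite nth_uniq // => /eqP; exact: val_inj.
apply/seteqP; split => x.
  by move=> [i _ <-] /=; rewrite -rs; exact: mem_tnth.
rewrite /= -rs => xr; have /tnthP[i ->] : x \in in_tuple r by [].
by exists i.
Qed.

Section Rays.
Context {R : realType} {S : conicalComplex R} (L : integralStructure S).
Implicit Types (a b d : cell S) (x y z : S) (T F : set S) (K : set (cell S)).
Implicit Types (D : set (set S)).
Local Notation V a := (linear_fun a).

(** A combination of points lying on the rays of some of the [v i] is a
    combination of these [v i]; several points may share a ray. *)
Lemma lincomb_regroup a (I J : finType) x (c : J -> R) (p : J -> S)
    (v : I -> S) (P : I -> Prop) :
  (forall j, 0 <= c j) -> lincomb (V a) x c p ->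
  (forall j, c j != 0 -> exists i, P i /\
    exists2 r, 0 <= r & forall u, V a u -> u (p j) = r * u (v i)) ->
  exists2 e, (forall i, 0 <= e i) & lincomb (V a) x e v /\ forall i, e i != 0 -> P i.
Proof.
move=> c0 xc H.
have H' j : exists e : I -> R, [/\ forall i, 0 <= e i, forall i, e i != 0 -> P i &
    forall u, V a u -> c j * u (p j) = \sum_i e i * u (v i)].
  have [cj|/H[i [Pi [r r0 ir]]]] := eqVneq (c j) 0.
    exists (fun=> 0); split => // [i|u Vu]; first by rewrite eqxx.
    by rewrite cj mul0r big1 // => i _; rewrite mul0r.
  exists (fun l => (l == i)%:R * (c j * r)); split.
  - by move=> l; rewrite !mulr_ge0.
  - by move=> l; have [->//|_] := eqVneq l i; rewrite mul0r eqxx.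
  - move=> u Vu; rewrite ir // (bigD1 i) //= eqxx mul1r big1 ?addr0 ?mulrA // => l /negPf ->.
    by rewrite !mul0r.
have {H'}[e eP] := choice H'.
exists (fun i => \sum_j e j i); first by move=> i; apply: sumr_ge0 => j _; have [] := eP j.
split=> [u Vu|i].
  under [RHS]eq_bigr do rewrite mulr_suml.
  rewrite exchange_big /= (xc u Vu); apply: eq_bigr => j _.
  by have [_ _ ->] := eP j.
move=> ne; apply: contrapT => nP; move/eqP: ne; apply.
apply: big1 => j _; have [_ eQ _] := eP j.
by apply/eqP/negPn/negP => /eQ.
Qed.

(** A one-dimensional cell cannot be subdivided: the cone of [D] containing [x]
    intersects it in a face, and this face contains the whole ray. *)
Lemma cone_ray_mem K D b x : subdivision L K D -> K b -> cone b = ray x ->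
  x <> origin S -> D (cone b).
Proof.
move=> sD Kb bx xo; have xb : cone b x by rewrite bx; exact: ray_refl.
have : support K x by exists b.
rewrite -(subdivision_support sD) => -[T DT Tx].
have [a Ka rT] := subdivision_cone sD DT.
have [m [p [pi TE]]] := (rational_hullP L a T).1 rT.
have aT : T `<=` cone a by case: rT.
have ax := aT _ Tx.
have dbE : cone (relint_cell x) = cone b.
  apply/seteqP; split; first exact: (subcell_sub (relint_cell_subcell xb)).
  by rewrite bx; apply: ray_sub; exact: relint_cell_cone.
have [[m' [Vm m0 dE]] _] := relint_cell_subcell ax.
suff -> : cone b = T `&` [set y | m' y = 0].
  apply: (subdivision_face sD Ka DT aT); apply/(cell_faceP _ aT).
  by exists m' => //; split => // y /aT /m0.
rewrite -dbE; apply/seteqP; split => y; last first.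
  by move=> [/aT ay my]; rewrite dE.
move=> yd; split; last by move: yd; rewrite dE => -[].
move: yd; rewrite dbE bx (ray_cell ax) TE; apply: hull_trans => _.
by rewrite -TE.
Qed.

Lemma dual_transfer a b d u : subcell d a -> subcell d b -> V b u ->
  exists2 u', V a u' & forall x, cone d x -> u' x = u x.
Proof.
move=> da db Vu; have [u1 Vu1 u1E] := subcell_fun db Vu.
have [u2 Vu2 u2E] := subcell_ext da Vu1.
by exists u2 => // x dx; rewrite -u2E // u1E.
Qed.

(** A simplicial cone with its generators and the dual basis of linear functions.
    The cell [b] in which it is known to be simplicial need not be [a]; the
    functions are transferred through a common face. *)
Lemma simplicial_dual a T : simplicial T -> T `<=` cone a ->
  exists m (q : 'I_m -> S) (dl : 'I_m -> S -> R),
    [/\ forall j, cone a (q j), T = hull a q, forall j, V a (dl j)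
      & forall i j, dl j (q i) = (i == j)%:R].
Proof.
move=> [b [bT [k [f [fb [m [t [tfree tE]]]]]]]] aT.
have [q [bq qt TE]] := chart_conic_hullP fb bT tE.
have aT' : hull b q `<=` cone a by rewrite -TE.
have [d [da db dq]] := hull_local bq aT'.
have [aq hE] := hull_transfer bq aT'.
pose A := \matrix_(i < m) t i.
pose l j := col j (pinvmx A).
have lq i j : (chart f (q i) *m l j) 0 0 = (i == j)%:R.
  have -> : chart f (q i) = row i A by rewrite rowK.
  by rewrite /l colE mulmxA -row_mul mulmxVp // -colE !mxE.
have H j : exists u, V a u /\ forall x, cone d x -> u x = (chart f x *m l j) 0 0.
  by have [u Vu uE] := dual_transfer da db (chart_fun fb (l j)); exists u.
have {H}[dl dlP] := choice H.
exists m, q, dl; split => //; first by rewrite TE.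
  by move=> j; have [] := dlP j.
by move=> i j; have [_ ->] := dlP j.
Qed.

(** The sum of the other dual functions cuts out the ray. *)
Lemma simplicial_ray_face a m (q : 'I_m -> S) (dl : 'I_m -> S -> R) j :
  (forall j, cone a (q j)) -> (forall j, V a (dl j)) ->
  (forall i j, dl j (q i) = (i == j)%:R) ->
  face_in (V a) (hull a q) (ray (q j)).
Proof.
move=> aq Vdl dlq; apply/(cell_faceP _ (@hull_sub _ _ _ _ _)).
have dlx x c i : lincomb (V a) x c q -> dl i x = c i.
  move=> xc; rewrite xc // (bigD1 i) //= dlq eqxx mulr1 big1 ?addr0 // => l /negPf li.
  by rewrite dlq li mulr0.
exists (fun x => \sum_(i | i != j) 1 * dl i x).
  by apply: linear_fun_sum; [exact: linear_fun_findim|move=> i _; exact: Vdl].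
split=> [x [ax [c c0 xc]]|].
  by apply: sumr_ge0 => i _; rewrite mul1r (dlx _ _ _ xc).
apply/seteqP; split => x.
  move=> xr; split.
    by move: xr; rewrite (ray_cell (aq j)); apply: hull_trans => _; exact: hull_gen.
  move: xr => /(rayP _ (aq j))[ax [r r0 xr]] /=; rewrite big1 // => i ij.
  by rewrite xr // dlq eq_sym (negPf ij) mulr0 mulr0.
move=> [[ax [c c0 xc]] /= /eqP]; rewrite psumr_eq0; last first.
  by move=> i _; rewrite mul1r (dlx _ _ _ xc).
move=> /allP ci0; apply/(rayP _ (aq j)); split => //; exists (c j) => // u Vu.
rewrite (xc u Vu) (bigD1 j) //= big1 ?addr0 // => i ij.
have := ci0 i (mem_index_enum _); rewrite ij mul1r (dlx _ _ _ xc) => /eqP ->.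
by rewrite mul0r.
Qed.

Definition edges D : set (set S) := Sk1 (cones (S := S)) `|` Sk1 D.

Lemma cone_rational b : rational_in L b (cone b).
Proof.
split => //; have [k [f fb]] := latticeP L b; exists k, f; split => //.
exact: lattice_rational fb.
Qed.

Lemma edge_integral_ray a T : rational_in L a T -> is_edge T ->
  exists x, [/\ x <> origin S, integral_point L a x & T = ray x].
Proof.
move=> rT eT; have [m [p [pi TE]]] := (rational_hullP L a T).1 rT; subst T.
have ap i : cone a (p i) by case: (pi i).
have [x xo xE] := edge_ray ap eT.
have Tx : hull a p x by rewrite xE; exact: ray_refl.
have [y [Ty yo yi]] := rational_point rT Tx xo.
exists y; split; [exact: yo|exact: yi|exact: (edge_ray_point ap eT Ty yo)].
Qed.

(** Any enumeration of the edges will do: they generate every cell, because the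
    extreme rays of a cell are themselves cells. *)
Lemma edge_family K D : subdivision L K D -> exists N (v : 'I_N -> S),
  [/\ generating L v, forall i j, ray (v i) = ray (v j) -> i = j
    & edges D = [set ray (v i) | i in [set: 'I_N]]].
Proof.
move=> sD; have fE : finite_set (edges D).
  rewrite /edges finite_setU; split.
    apply: (@sub_finite_set _ _ (cones (S := S))); first by move=> T [].
    exact/finite_image/finite_finset.
  by apply: (@sub_finite_set _ _ D); [move=> T []|exact: subdivision_finite sD].
have [N [e [einj eE]]] := finite_set_enum fE.
have H i : exists x, [/\ x <> origin S, exists a, integral_point L a x & e i = ray x].
  have : edges D (e i) by rewrite -eE; exists i.
  move=> [[[b _ bE] eT]|[De eT]].
    rewrite -bE in eT *; have [x [xo xi xE]] := edge_integral_ray (cone_rational b) eT.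
    by exists x; split => //; exists b.
  have [a _ rT] := subdivision_cone sD De.
  have [x [xo xi xE]] := edge_integral_ray rT eT.
  by exists x; split => //; exists a.
have {H}[v vP] := choice H.
have vE i : e i = ray (v i) by have [] := vP i.
exists N, v; split.
- split.
  + by move=> i; have [] := vP i.
  + by move=> i a ai; have [_ [b bi] _] := vP i; exact: integral_any bi ai.
  + move=> a x ax; have [m [p [ap pgen]]] := cell_extreme_generated a.
    have [c c0 [xc cex]] := pgen x ax.
    apply: (lincomb_regroup c0 xc) => j /cex[po [b ba bE]].
    have : edges D (cone b).
      by left; split; [exists b|rewrite bE; exact: ray_edge].
    rewrite -eE => -[i _ iE].
    have bv : cone b (v i) by rewrite -iE vE; exact: ray_refl.
    have av := subcell_sub ba bv.
    exists i; split => //.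
    have : ray (v i) (p j) by rewrite -vE iE bE; exact: ray_refl.
    by move=> /(rayP _ av)[].
- by move=> i j; rewrite -!vE; exact: einj.
- by rewrite -eE; apply/seteqP; split => T [i _ <-]; exists i.
Qed.

End Rays.

(** * The given triangulation is regular *)

Section LiftingConcave.
Context {R : realType} {S : conicalComplex R} (L : integralStructure S).
Implicit Types (a b d : cell S) (x y z : S) (T F : set S) (K : set (cell S)).
Local Notation V a := (linear_fun a).

Lemma lifting_origin K f a : lifting_function L K f -> K a -> f (origin S) = 0.
Proof.
move=> lf Ka; rewrite (lifting_homogeneous lf Ka (lexx 0) (x := origin S)) ?mul0r //.
split; try exact: origin_cone.
by move=> u Vu; rewrite (origin_val Vu) !mul0r addr0.
Qed.

(** Concavity for finite combinations, by adding one term at a time. *)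
Lemma lifting_jensen K f a (I : finType) x (c : I -> R) p : lifting_function L K f -> K a ->
  (forall i, 0 <= c i) -> (forall i, c i != 0 -> cone a (p i)) -> cone a x ->
  lincomb (V a) x c p -> \sum_i c i * f (p i) <= f x.
Proof.
move=> lf Ka c0 ca ax xc.
have H (s : seq I) : exists z, [/\ cone a z, forall u, V a u -> u z = \sum_(i <- s) c i * u (p i)
    & \sum_(i <- s) c i * f (p i) <= f z].
  elim: s => [|i s [z [az zE zf]]].
    exists (origin S); split; first exact: origin_cone.
      by move=> u Vu; rewrite big_nil (origin_val Vu).
    by rewrite big_nil (lifting_origin lf Ka).
  have [ci|ci] := eqVneq (c i) 0.
    exists z; split => // [u Vu|]; rewrite big_cons ci mul0r add0r //.
    exact: zE.
  have ai := ca i ci.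
  have [y ay yE] := @cell_conic_closed _ _ a bool (fun o => if o then c i else 1)
    (fun o => if o then p i else z) ltac:(by case=> //=; exact: c0) ltac:(by case).
  have {}yE u : V a u -> u y = c i * u (p i) + 1 * u z by move=> /yE ->; rewrite big_bool.
  exists y; split => // [u Vu|]; rewrite big_cons.
    by rewrite yE // zE // mul1r.
  apply: (le_trans _ (lifting_convex lf Ka (c0 i) ler01 (And4 ai az ay yE))).
  by rewrite mul1r lerD2l.
have [z [az zE zf]] := H (index_enum I).
by have <- : z = x by apply: (@cell_separated _ _ a) => // u Vu; rewrite zE // xc.
Qed.
End LiftingConcave.

Section Base.
Context {R : realType} {S : conicalComplex R} (L : integralStructure S).
Implicit Types (a b d : cell S) (x y z : S) (T F : set S).
Local Notation V a := (linear_fun a).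
Variables (h : S -> R) (S0 : set (cell S)) (D0 : set (set S)) (f0 : S -> R).
Hypothesis h_slicing : slicing_function h.
Hypothesis S0_sub : subcomplex S0.
Hypothesis D0_triang : triangulation L S0 D0.
Hypothesis f0_lifting : lifting_function L S0 f0.
Hypothesis f0_induced : induced_by L S0 f0 D0.
Variables (N : nat) (v : 'I_N -> S).
Hypothesis vG : generating L v.
Hypothesis v_inj : forall i j, ray (v i) = ray (v j) -> i = j.
Hypothesis v_edges : edges D0 = [set ray (v i) | i in [set: 'I_N]].

Let sD0 : subdivision L S0 D0 := D0_triang.1.

Lemma base_ray a i : S0 a -> cone a (v i) -> D0 (ray (v i)).
Proof.
move=> Sa ai; have : edges D0 (ray (v i)) by rewrite v_edges; exists i.
move=> [[[b _ bE] _]|[]//]; rewrite -bE.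
apply: (cone_ray_mem sD0 _ bE); last exact: (generating_origin vG).
apply: (S0_sub Sa); apply: subcell_face_of; apply: cone_subcell.
by rewrite bE; exact: ray_sub.
Qed.

(** The generators of a simplicial cone of [D0] span faces of it, hence edges
    that belong to [D0] and so carry one of the [v i]. *)
Lemma base_gen a T x : S0 a -> D0 T -> T `<=` cone a -> T x ->
  exists2 e, (forall i, 0 <= e i) & lincomb (V a) x e v /\ forall i, e i != 0 -> T (v i).
Proof.
move=> Sa DT aT Tx.
have [m [q [dl [aq TE Vdl dlq]]]] := simplicial_dual (D0_triang.2 _ DT) aT.
move: (Tx); rewrite {1}TE => -[ax [c c0 xc]].
apply: (lincomb_regroup c0 xc) => j _.
have qo : q j <> origin S.
  move=> qo; have := dlq j j; rewrite qo (origin_val (Vdl j)) eqxx => /eqP.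
  by rewrite eq_sym oner_eq0.
have Dq : D0 (ray (q j)).
  apply: (subdivision_face sD0 Sa DT aT); rewrite TE.
  exact: simplicial_ray_face Vdl dlq.
have : edges D0 (ray (q j)) by right; split => //; exact: ray_edge.
rewrite v_edges => -[i _ iE].
have rT : ray (q j) `<=` T.
  by rewrite TE (ray_cell (aq j)); apply: hull_trans => _; exact: hull_gen.
have Tv : T (v i) by apply: rT; rewrite -iE; exact: ray_refl.
exists i; split; first exact: Tv.
have : ray (v i) (q j) by rewrite iE; exact: ray_refl.
by move=> /(rayP _ (aT _ Tv))[].
Qed.

(** A generator [v i] in a cone [T] of [D0] spans a ray of [D0], which is a face
    of [T] and hence the ray of one of the elements [q j] of a basis of [T].
    Distinct [v i] give distinct [q j], and the dual function [dl j] isolates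
    the coefficient of [v i]. *)
Lemma base_independent a w u : S0 a -> majorant v a w u -> D0 (contact_cone v a w u) ->
  independent v a (tight v a w u).
Proof.
move=> Sa uw; set B := tight v a w u; set T := contact_cone v a w u => DT.
have aT : T `<=` cone a by exact: hull_sub.
have [m [q [dl [aq TE Vdl dlq]]]] := simplicial_dual (D0_triang.2 _ DT) aT.
(* Every tight generator spans the same ray as some [q j]. *)
have key i : i \in B -> exists j r, 0 < r /\ forall u', V a u' -> u' (q j) = r * u' (v i).
  move=> iB; have Tv : T (v i) by exact: contact_cone_gen.
  have av := aT _ Tv; have rT : ray (v i) `<=` T.
    by rewrite (ray_cell av); apply: hull_trans => _.
  have [+ _] := subdivision_meet sD0 Sa DT (base_ray Sa av) aT (subset_trans rT aT).
  rewrite (_ : T `&` ray (v i) = ray (v i)); last exact/setIidPr.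
  move=> /(cell_faceP _ aT)[m' Vm [m0 rE]].
  move: (Tv); rewrite {1}TE => -[_ [c c0 vc]].
  have [j cj] : exists j, c j != 0.
    apply: contrapT => /forallNP cn; apply: (generating_origin vG (i := i)).
    apply: (@cell_separated _ _ a) => //; first exact: origin_cone.
    move=> u' Vu'; rewrite (vc u' Vu') (origin_val Vu') big1 // => j _.
    by have /negP := cn j; rewrite negbK => /eqP ->; rewrite mul0r.
  have Tq l : T (q l) by rewrite TE; exact: hull_gen.
  have qo : q j <> origin S.
    move=> qo; have := dlq j j; rewrite qo (origin_val (Vdl j)) eqxx => /eqP.
    by rewrite eq_sym oner_eq0.
  have rq : ray (v i) (q j).
    rewrite rE; split => //=.
    have : ray (v i) (v i) by exact: ray_refl.
    rewrite rE => -[_ /= /eqP]; rewrite (vc m' Vm) psumr_eq0; last first.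
      by move=> l _; rewrite mulr_ge0 // m0.
    move=> /allP /(_ j (mem_index_enum _)) /=.
    by rewrite mulf_eq0 (negPf cj) => /eqP.
  by have [r r0 rr] := ray_pos av qo rq; exists j, r.
move=> c cB cE i; have [iB|iB] := boolP (i \in B); last by apply: contraNeq iB => /cB.
have [j [r [r0 rr]]] := key i iB.
have dlv i' : i' \in B -> i' != i -> dl j (v i') = 0.
  move=> iB' ii; have [j' [r' [r0' rr']]] := key i' iB'.
  have := rr' _ (Vdl j); rewrite dlq; have [jj|_] := eqVneq j' j; last first.
    by move=> /esym/eqP; rewrite mulf_eq0 gt_eqF //= => /eqP.
  move=> _; exfalso; move/eqP: ii; apply; apply: v_inj.
  have av i2 : i2 \in B -> cone a (v i2) by move=> /tightP[].
  have qo : q j <> origin S.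
    move=> qo; have := dlq j j; rewrite qo (origin_val (Vdl j)) eqxx => /eqP.
    by rewrite eq_sym oner_eq0.
  have e1 : ray (q j) = ray (v i).
    apply: (ray_eq qo); apply/(rayP _ (av _ iB)); split; first exact: aq.
    by exists r; [exact: ltW|exact: rr].
  have e2 : ray (q j) = ray (v i').
    apply: (ray_eq qo); apply/(rayP _ (av _ iB')); split; first exact: aq.
    by exists r'; [exact: ltW|move: rr'; rewrite jj].
  exact: (etrans (esym e2) e1).
have := cE _ (Vdl j); rewrite (bigD1 i) //= big1 ?addr0 => [/eqP|i' ii]; last first.
  have [iB'|iB'] := boolP (i' \in B); first by rewrite dlv // mulr0.
  have -> : c i' = 0 by apply: contraNeq iB' => /cB.
  by rewrite mul0r.
rewrite mulf_eq0 => /orP[/eqP //|/eqP di].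
by have := rr _ (Vdl j); rewrite dlq eqxx di mulr0 => /eqP; rewrite oner_eq0.
Qed.

Definition base_height (i : 'I_N) : R :=
  if pselect (exists2 a, S0 a & cone a (v i)) then f0 (v i) else 0.

Lemma base_heightE a i : S0 a -> cone a (v i) -> base_height i = f0 (v i).
Proof. by move=> Sa ai; rewrite /base_height; case: pselect => // -[]; exists a. Qed.

Lemma base_height_rational i : exists q : rat, base_height i = ratr q.
Proof.
rewrite /base_height; case: pselect => [[a Sa ai]|n] /=; last by exists 0; rewrite rmorph0.
exact: (lifting_rational f0_lifting Sa (generating_integral vG ai)).
Qed.

(** A cone of [D0] writes [x] as a combination of generators on which [f0] is
    linear, so [f0 x] is at most the upper hull; concavity of [f0] gives the
    other inequality. *)
Lemma base_upper_hull a x : S0 a -> cone a x -> f0 x = upper_hull v base_height x.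
Proof.
move=> Sa ax; have : support S0 x by exists a.
rewrite -(subdivision_support sD0) => -[T DT Tx].
have [b Sb [bT _]] := subdivision_cone sD0 DT.
have bx := bT _ Tx.
have [l lw xl] := majorant_exists h_slicing vG base_height bx.
rewrite (upper_hullE lw xl); apply/eqP; rewrite eq_le; apply/andP; split.
  have [e e0 [xe eT]] := base_gen Sb DT bT Tx.
  have [_ /(_ b T Sb DT bT)[u Vu uE] _] := f0_induced.
  rewrite uE // (xe u Vu).
  have eb i : e i != 0 -> cone b (v i) by move=> /eT /bT.
  apply: le_trans (lincomb_le_majorant lw e0 eb xe).
  apply: ler_sum => i _; have [->|ei] := eqVneq (e i) 0; first by rewrite !mul0r.
  by rewrite (base_heightE Sb (eb i ei)) uE //; exact: eT.
have /(contact_coneP _ lw)[_ [c c0 [xc cb ->]]] := xl.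
apply: le_trans (lifting_jensen f0_lifting Sb c0 cb bx xc).
apply: ler_sum => i _; have [->|ci] := eqVneq (c i) 0; first by rewrite !mul0r.
by rewrite (base_heightE Sb (cb i ci)).
Qed.

Lemma linear_on_eq a T f g : T `<=` cone a ->
  (forall x, cone a x -> f x = g x) -> linear_on a T f -> linear_on a T g.
Proof. by move=> aT fg [u Vu uE]; exists u => // x Tx; rewrite -uE // fg //; exact: aT. Qed.

(** Both sides are the coarsest subdivision on whose cones [f0] is linear. *)
Lemma base_regular : D0 = regular_subdivision v S0 base_height.
Proof.
have sD := regular_subdivisionP h_slicing vG S0 base_height.
have [_ lin0 coarse0] := f0_induced.
have c1 T : D0 T -> exists2 T', regular_subdivision v S0 base_height T' & T `<=` T'.
  move=> DT; have [a Sa rT] := subdivision_cone sD0 DT; have aT : T `<=` cone a by case: rT.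
  apply: (regular_coarsest h_slicing vG Sa rT).
  by apply: (linear_on_eq aT _ (lin0 a T Sa DT aT)) => x; exact: base_upper_hull.
have c2 T : regular_subdivision v S0 base_height T -> exists2 T', D0 T' & T `<=` T'.
  apply: (coarse0 _ sD) => a T' Sa DT aT.
  apply: (linear_on_eq aT _ (regular_linear h_slicing vG Sa DT aT)) => x ax.
  by rewrite (base_upper_hull Sa ax).
apply/seteqP; split; [exact: (subdivision_mutual sD0 sD c1 c2)|exact: (subdivision_mutual sD sD0 c2 c1)].
Qed.

End Base.

(** * Perturbation of the heights *)

Lemma horner_harmonic_gt0 (R : realType) (p : {poly R}) : 0 < p.[0] ->
  \forall n \near \oo, 0 < p.[n.+1%:R^-1].
Proof.
move=> p0.
have : (fun n => p.[@harmonic R n]) @ \oo --> p.[0].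
  by apply: (cvg_comp _ _ cvg_harmonic); exact: continuous_horner.
by move=> /cvgr_gt/(_ 0 p0).
Qed.

(** After division by a power of ['X] the constant coefficient is nonzero, and
    continuity at [0] applies; the powers of ['X] do not vanish at
    [n.+1%:R^-1]. *)
Lemma horner_harmonic_neq0 (R : realType) (p : {poly R}) : p != 0 ->
  \forall n \near \oo, p.[n.+1%:R^-1] != 0.
Proof.
elim/poly_ind: p => [|p c IH]; first by rewrite eqxx.
have [->|c0 _] := eqVneq c 0.
  rewrite addr0 mulf_eq0 negb_or => /andP[/IH + _]; apply: filterS => n pn.
  by rewrite hornerM hornerX mulf_neq0 // invr_eq0 pnatr_eq0.
(* Up to a sign, [c] is positive. *)
wlog c1 : c p c0 {IH} / 0 < c => [H|].
  have [cp|cn|/eqP] := ltgtP c 0; last by rewrite (negPf c0).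
    have := H (- c) (- p); rewrite oppr_eq0 oppr_gt0 => /(_ c0 cp).
    apply: filterS => n; apply: contraNN => /eqP e; apply/eqP.
    by move: e; rewrite polyCN mulNr -opprD hornerN => ->; rewrite oppr0.
  exact: H.
have /horner_harmonic_gt0 : 0 < (p * 'X + c%:P).[0].
  by rewrite hornerD hornerM hornerX mulr0 add0r hornerC.
by apply: filterS => n /lt0r_neq0.
Qed.

Section Perturbation.
Context {R : realType} {S : conicalComplex R}.
Implicit Types (a b d : cell S) (x y z : S) (T F : set S).
Local Notation V a := (linear_fun a).
Variables (N : nat) (v : 'I_N -> S) (w : 'I_N -> R).

(** The powers of a small parameter: different generators get different powers,
    so that a nontrivial relation between the heights is a nonzero polynomial in
    the parameter. *)
Definition perturbed (n : nat) (i : 'I_N) : R := w i + n.+1%:R^-1 ^+ i.+1.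

(** For each cell and each dependent set of generators fix one dependency [c].
    If a majorant were tight on the set, [c] would annihilate the heights, a
    polynomial condition that excludes all large [n].  There are finitely many
    cells and sets. *)
Lemma perturbed_independent : \forall n \near \oo, forall a u, majorant v a (perturbed n) u ->
  independent v a (tight v a (perturbed n) u).
Proof.
pose dep a (B : {set 'I_N}) (c : 'I_N -> R) := [/\ forall i, c i != 0 -> i \in B,
  forall u, V a u -> \sum_i c i * u (v i) = 0 & exists i, c i != 0].
pose P (aB : (cell S * {set 'I_N})%type) : set nat := [set n |
  (exists c, dep aB.1 aB.2 c) -> exists2 c, dep aB.1 aB.2 c & \sum_i c i * perturbed n i != 0].
suff : \forall n \near \oo, forall aB, P aB n.
  apply: filterS => n Pn a u [Vu uw] c cB cE i.
  apply/eqP/negPn/negP => ci.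
  have [|e [eB eE _] /eqP] := Pn (a, tight v a (perturbed n) u); first by exists c; split => //; exists i.
  apply; rewrite -[RHS](eE u Vu); apply: eq_bigr => j _.
  have [->|/eB/tightP[_ ->]//] := eqVneq (e j) 0; first by rewrite !mul0r.
apply: (@filter_forall _ _ P (nbhs \oo) _) => -[a B]; rewrite /P /=.
have [[c cd]|nd] := pselect (exists c, dep a B c); last by apply: nearW => n /nd.
(* Its value at [t] is the relation between the perturbed heights. *)
pose p : {poly R} := (\sum_i c i * w i)%:P + \poly_(i < N) (oapp c 0 (insub i)) * 'X.
have pE n : p.[n.+1%:R^-1] = \sum_i c i * perturbed n i.
  rewrite hornerD hornerC hornerM hornerX horner_poly mulr_suml -big_split /=.
  by apply: eq_bigr => i _; rewrite valK /= /perturbed exprSr; ring.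
have : p != 0.
  have [_ _ [i ci]] := cd; apply: contraNneq ci => p0.
  have := congr1 (fun q : {poly R} => q`_i.+1) p0.
  by rewrite coefD coefC /= add0r coefMX /= coef_poly ltn_ord valK /= coef0 => ->.
move=> /horner_harmonic_neq0; apply: filterS => n; rewrite pE => ne _.
by exists c.
Qed.

(** If [v j] is independent of the other points in [B], it is not in their span,
    and some function vanishes on them but not at [v j]. *)
Lemma independent_dual a (B : {set 'I_N}) : independent v a B ->
  exists dl : 'I_N -> S -> R, forall j, V a (dl j) /\
    (j \in B -> forall i, i \in B -> dl j (v i) = (i == j)%:R).
Proof.
move=> ind; have [k [f fb]] := linear_fun_findim a.
suff H j : exists u : S -> R, V a u /\
    (j \in B -> forall i, i \in B -> u (v i) = (i == j)%:R).
  by have [dl dlP] := choice H; exists dl.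
have [jB|] := boolP (j \in B); last by exists (fun=> 0); split => //; apply: linear_fun0; exact: linear_fun_findim.
pose A := \matrix_(i < N) if (i \in B) && (i != j) then chart f (v i) else 0.
have AE i : i \in B -> i != j -> row i A = chart f (v i) by move=> iB ij; rewrite rowK iB ij.
have [/submxP[D DE]|] := boolP (chart f (v j) <= A)%MS.
  pose c i := if i == j then -1 else if i \in B then D 0 i else 0.
  exfalso; have := ind c _ _ j; rewrite /c eqxx => H.
  suff /eqP : -1 = 0 :> R by rewrite oppr_eq0 oner_eq0.
  apply: H => [i|u Vu].
    by have [->//|_] := eqVneq i j; case: ifP => // _; rewrite eqxx.
  rewrite (bigD1 j) //= eqxx mulN1r addrC; apply/eqP; rewrite subr_eq0; apply/eqP.
  have [l ul] := chart_funP fb Vu.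
  have Al i : (A *m l) i 0 = if (i \in B) && (i != j) then u (v i) else 0.
    have -> : (A *m l) i 0 = (row i A *m l) 0 0 by rewrite -row_mul [RHS]mxE.
    by rewrite rowK; case: ifP => _; [rewrite -ul|rewrite mul0mx mxE].
  rewrite [RHS]ul DE -mulmxA mxE [RHS](bigD1 j) //= Al eqxx andbF mulr0 add0r.
  apply: eq_bigr => i ij; rewrite Al (negPf ij) /= andbT.
  by case: ifP => // _; rewrite mulr0 mul0r.
rewrite submxE => /rV0Pn[l lne].
pose s := (chart f (v j) *m cokermx A) 0 l.
exists (fun x => (chart f x *m (s^-1 *: col l (cokermx A))) 0 0); split; first exact: chart_fun.
move=> _ i iB; rewrite -scalemxAr mxE colE mulmxA -colE mxE.
have [->|ij] := eqVneq i j; first by rewrite mulVf.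
by rewrite -(AE i iB ij) -row_mul mulmx_coker row0 mxE mulr0.
Qed.

(** On an independent tight set a majorant can be corrected by a combination of
    dual functions to match the perturbed heights.  The correction tends to
    zero, and therefore the inequalities that were strict remain so. *)
Lemma perturbed_stable : \forall n \near \oo, forall a u, majorant v a w u ->
  independent v a (tight v a w u) ->
  exists2 u', majorant v a (perturbed n) u' & tight v a (perturbed n) u' = tight v a w u.
Proof.
pose good a (B : {set 'I_N}) := exists u, [/\ majorant v a w u, tight v a w u = B & independent v a B].
pose P (aB : (cell S * {set 'I_N})%type) : set nat := [set n |
  good aB.1 aB.2 -> exists2 u', majorant v aB.1 (perturbed n) u' & tight v aB.1 (perturbed n) u' = aB.2].
suff : \forall n \near \oo, forall aB, P aB n.
  by apply: filterS => n Pn a u uw ind; apply: (Pn (a, _)); exists u.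
apply: (@filter_forall _ _ P (nbhs \oo) _) => -[a B]; rewrite /P /=.
have [[u [uw uB iB]]|ng] := pselect (good a B); last by apply: nearW => n /ng.
have [dl dlP] := independent_dual iB.
(* the corrected majorant *)
pose U n x := u x + \sum_(j in B) n.+1%:R^-1 ^+ j.+1 * dl j x.
have VU n : V a (U n).
  apply: linear_funD; [exact: linear_fun_findim|exact: uw.1|].
  by apply: linear_fun_sum; [exact: linear_fun_findim|move=> j _; have [] := dlP j].
have UB n i : i \in B -> U n (v i) = perturbed n i.
  move=> iB'; rewrite /U /perturbed (bigD1 i) //= (dlP i).2 // eqxx mulr1 big1 ?addr0; last first.
    by move=> j /andP[jB ji]; rewrite (dlP j).2 // eq_sym (negPf ji) mulr0.
  by move: iB'; rewrite -uB => /tightP[_ ->].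
have H : \forall n \near \oo, forall i, cone a (v i) -> i \notin B -> perturbed n i < U n (v i).
  apply: (@filter_forall _ _ (fun i n => cone a (v i) -> i \notin B -> perturbed n i < U n (v i)) (nbhs \oo) _) => i.
  have [ai|nai] := pselect (cone a (v i)); last by apply: nearW => n.
  have [iB'|niB] := boolP (i \in B); first by apply: nearW => n.
  (* The slack at [v i] is a polynomial in the parameter, positive at [0]. *)
  pose p : {poly R} := (u (v i) - w i)%:P + \sum_(j in B) dl j (v i) *: 'X^(j.+1) - 'X^(i.+1).
  have pE n : p.[n.+1%:R^-1] = U n (v i) - perturbed n i.
    rewrite /p hornerD hornerN hornerXn hornerD hornerC horner_sum /U /perturbed.
    under eq_bigr do rewrite hornerZ hornerXn mulrC.
    by ring.
  have : 0 < p.[0].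
    rewrite /p hornerD hornerN hornerXn hornerD hornerC horner_sum expr0n /= subr0 big1 ?addr0.
      rewrite subr_gt0 lt_neqAle uw.2 // andbT; apply: contraNneq niB => e.
      by rewrite -uB; apply/tightP.
    by move=> j _; rewrite hornerZ hornerXn expr0n mulr0.
  move=> /horner_harmonic_gt0; apply: filterS => n; rewrite pE subr_gt0 => lt _ _.
  exact: lt.
apply: filterS H => n Hn _; exists (U n).
  split => // i ai; have [iB'|niB] := boolP (i \in B); first by rewrite UB.
  by apply/ltW/Hn.
apply/setP => i; apply/idP/idP => [/tightP[ai ui]|iB'].
  by apply/negPn/negP => niB; have := Hn i ai niB; rewrite ui ltxx.
by apply/tightP; split; [move: iB'; rewrite -uB => /tightP[]|exact: UB].
Qed.

Lemma perturbed_rational n : (forall i, exists q : rat, w i = ratr q) ->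
  forall i, exists q : rat, perturbed n i = ratr q.
Proof.
move=> wq i; have [q qE] := wq i; exists (q + n.+1%:R^-1 ^+ i.+1).
by rewrite rmorphD /= rmorphXn /= fmorphV /= ratr_nat -qE.
Qed.

End Perturbation.

(** * Triangulations without new edges *)

Theorem corollary0p11 (R : realType) (S : conicalComplex R)
    (L : integralStructure S) (h : S -> R) (S0 : set (cell S))
    (D0 : set (set S)) :
  slicing_function h ->
  subcomplex S0 ->
  triangulation L S0 D0 ->
  induced_by_lifting L S0 D0 ->
  exists D : set (set S),
    [/\ triangulation L setT D,
        induced_by_lifting L setT D,
        restriction S0 D = D0
      & Sk1 D = Sk1 (cones (S := S)) `|` Sk1 D0].
Proof.
move=> hs S0s D0t [f0 f0l f0i].
have sD0 := D0t.1.
have [N [v [vG vinj vE]]] := edge_family sD0.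
pose w0 := base_height S0 f0 v.
have D0E : D0 = regular_subdivision v S0 w0 := base_regular hs D0t f0l f0i vG vE.
have [n _ /(_ n (leqnn n))[nind nst]] :=
  filterI (perturbed_independent v w0) (perturbed_stable v w0).
set w := perturbed w0 n in nind nst.
have wq i : exists q : rat, w i = ratr q.
  by apply: perturbed_rational; exact: (base_height_rational f0l vG).
have sD K : subdivision L K (regular_subdivision v K w) := regular_subdivisionP hs vG K w.
(* The cones of [D0] persist, so the two subdivisions of [S0] agree. *)
have resE : D0 = regular_subdivision v S0 w.
  apply: (subdivision_incl sD0 (sD S0)) => T DT.
  move: (DT); rewrite D0E => -[a Sa [u uw TE]].
  have [|u' u'w tE] := nst a u uw.
    by apply: (base_independent S0s D0t vG vinj vE Sa uw); rewrite -TE.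
  by exists a => //; exists u' => //; rewrite TE /contact_cone tE.
exists (regular_subdivision v setT w).
have resD : restriction S0 (regular_subdivision v setT w) = D0.
  rewrite resE; apply/seteqP; split => T.
    by move=> [DT [a Sa aT]]; have [u uw TE] := regular_local hs vG DT aT; exists a => //; exists u.
  move=> [a Sa [u uw ->]]; split; first by exists a => //; exists u.
  by exists a => //; exact: hull_sub.
split => //.
- split; first exact: sD.
  by move=> _ [a _ [u uw ->]]; apply: contact_cone_simplicial; exact: nind.
- exists (upper_hull v w); first exact: (upper_hull_lifting hs vG wq nind).
  split; [exact: sD|exact: (regular_linear hs vG)|].
  move=> D' sD' lin T DT; have [a Ka rT] := subdivision_cone sD' DT.
  have aT : T `<=` cone a by case: rT.
  exact: (regular_coarsest hs vG Ka rT (lin a T Ka DT aT)).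
- apply/seteqP; split => T.
    move=> [[a _ [u uw TE]] eT].
    have ta := @tight_cone _ _ _ v a w u.
    have eT' : is_edge (hull a (masked v (tight v a w u))) by rewrite -/(contact_cone v a w u) -TE.
    have [x xo xE] := edge_ray ta eT'.
    have : contact_cone v a w u x by rewrite /contact_cone xE; exact: ray_refl.
    rewrite {1}/contact_cone hull_masked => -[ax [c c0 [xc cB]]].
    have [i ci] : exists i, c i != 0.
      apply: contrapT => /forallNP cn; apply: xo.
      apply: (@cell_separated _ _ a) => //; first exact: origin_cone.
      move=> u' Vu'; rewrite (xc u' Vu') (origin_val Vu') big1 // => j _.
      by have /negP := cn j; rewrite negbK => /eqP ->; rewrite mul0r.
    have Tv : hull a (masked v (tight v a w u)) (v i) by apply: contact_cone_gen; exact: cB.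
    have -> : T = ray (v i).
      rewrite TE; exact: (edge_ray_point ta eT' Tv (generating_origin vG (i := i))).
    by rewrite -/(edges D0) vE; exact: imageP.
  move=> [[[b _ bE] eT]|[DT eT]]; split => //.
    rewrite -bE in eT *; have [x [xo _ xE]] := edge_integral_ray (cone_rational L b) eT.
    exact: (cone_ray_mem (sD setT) (b := b) I xE xo).
  by move: DT; rewrite -resD => -[].
Qed.
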